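(* (Valuative Cohen theorem.) Let $R$ be a complete noetherian equicharacteristic local domain, fix a field of representatives $k\subset R$, let $\nu$ be a rational valuation of $R$ (centered in the maximal ideal), and let $(\overline\xi_i)_{i\in I}$ be a minimal system of homogeneous generators of the $k$-algebra $\mathrm{gr}_\nu R$. Then there exist choices of representatives $\xi_i\in R$ of the $\overline\xi_i$ such that the surjective map of $k$-algebras $k[(U_i)_{i\in I}]\to\mathrm{gr}_\nu R$, $U_i\mapsto\overline\xi_i$, is the associated graded map of a continuous surjective map $\widehat{k[(u_i)_{i\in I}]}\to R$, $u_i\mapsto\xi_i$, of topological $k$-algebras, with respect to the weight and valuation filtrations respectively. The kernel of this map is generated, up to closure, by overweight deformations of binomials generating the kernel of $k[(U_i)_{i\in I}]\to\mathrm{gr}_\nu R$.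
   Context: A valuation $\nu$ of $(R,m)$ with valuation ring $(R_\nu,m_\nu)$ dominating $R$ is rational if $R/m= R_\nu/m_\nu$. $\Phi$ is its (totally ordered) value group, $\Gamma=\nu(R\setminus\{0\})$ its semigroup of values on $R$, which is well ordered. For $\phi\in\Phi_{\ge0}$, $\mathcal{P}_\phi(R)=\{x:\nu(x)\ge\phi\}$, $\mathcal{P}_\phi^+(R)=\{x:\nu(x)>\phi\}$ and $\mathrm{gr}_\nu R=\bigoplus_\phi\mathcal{P}_\phi(R)/\mathcal{P}^+_\phi(R)$. Because $\nu$ is rational every nonzero homogeneous component of $\mathrm{gr}_\nu R$ is one-dimensional over $k$; the degrees $\gamma_i=\deg\overline\xi_i$ form the minimal system of generators of $\Gamma$, indexed by an ordinal $I$, and the kernel of $k[(U_i)_{i\in I}]\to\mathrm{gr}_\nu R$ is a prime ideal generated by binomials $U^{m^\ell}-\lambda_\ell U^{n^\ell}$, $\lambda_\ell\in k^*$. A representative of $\overline\xi_i$ is an element $\xi_i\in R$ whose $\nu$-initial form is $\overline\xi_i$. Scalewise completion: give the variable $u_i$ the weight $w(u_i)=\gamma_i$. $\widehat{k[(u_i)_{i\in I}]}$ is the $k$-algebra of all formal sums $\sum_e d_eu^e$, $d_e\in k$, over arbitrary sets of monomials $u^e$ in the variables $u_i$ (each monomial involving finitely many variables); multiplication makes sense because only finitely many monomials have a given weight. The weight $w$ of a series is the least weight of its terms. The filtration by the ideals of elements of weight $\ge\phi$ defines its topology, and its associated graded ring is $k[(U_i)_{i\in I}]$, where $U_i$, the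 initial form of $u_i$, has degree $\gamma_i$. Overweight deformations of the binomials $u^{m^\ell}-\lambda_\ell u^{n^\ell}$ are series obtained by adding to each $u^{m^\ell}-\lambda_\ell u^{n^\ell}$ a series of terms of weight strictly greater than $w(u^{m^\ell})=w(u^{n^\ell})$, in such a way that the ideal of $w$-initial forms of the elements of the ideal which they generate is the original binomial ideal. ''Generated up to closure'' means that the kernel is the closure of the ideal generated by these elements. *)

(* Defs.v *)
From HB Require Import structures.
From mathcomp Require Import all_boot all_order all_algebra ring_quotient finmap.
From mathcomp Require Import monalg.
From mathcomp Require Import boolp classical_sets functions cardinality fsbigop.
From mathcomp Require Import filter topology_structure.

Set Implicit Arguments.
Unset Strict Implicit.
Unset Printing Implicit Defensive.

Import Order.TTheory GRing.Theory.

Local Open Scope classical_set_scope.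
Local Open Scope ring_scope.

HB.mixin Record isOrderedGroup Phi of Num.POrderedZmodule Phi := {
  og_total : total (<=%R : rel Phi);
  og_leD2r : forall z x y : Phi, x <= y -> x + z <= y + z
}.

#[short(type="orderedGroupType")]
HB.structure Definition OrderedGroup :=
  {Phi of Num.POrderedZmodule Phi & isOrderedGroup Phi}.

Section OrderedGroupTheory.
Variable Phi : orderedGroupType.
Implicit Types x y z : Phi.

Lemma og_leD x y z t : x <= y -> z <= t -> x + z <= y + t.
Proof.
move=> xy zt; apply: (le_trans (og_leD2r z _ _ xy)).
by rewrite ![y + _]addrC; exact: og_leD2r.
Qed.

Lemma og_ltD2r z x y : x < y -> x + z < y + z.
Proof.
rewrite !lt_neqAle => /andP[xy lexy]; rewrite og_leD2r // andbT.
by apply: contra_neq xy => /addIr.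
Qed.

Lemma og_ltleD x y z t : x < y -> z <= t -> x + z < y + t.
Proof.
move=> xy zt; apply: (lt_le_trans (og_ltD2r z xy)).
by rewrite ![y + _]addrC; exact: og_leD2r.
Qed.

End OrderedGroupTheory.

(* The positive part of an ordered group; it is written multiplicatively
   (unit mone, product mmul) because it serves as monoid of exponents in
   {malg A[nneg Phi]}. *)
Record nneg (Phi : orderedGroupType) := NNeg {
  nneg_val :> Phi;
  nneg_ge0 : 0 <= nneg_val
}.

Section NNeg.
Variable Phi : orderedGroupType.

HB.instance Definition _ := [isSub for @nneg_val Phi].
HB.instance Definition _ := [Choice of nneg Phi by <:].

Definition nneg0 : nneg Phi := NNeg (lexx 0).

Fact nnegD_subproof (a b : nneg Phi) : 0 <= (a : Phi) + (b : Phi).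
Proof. by rewrite -[0]addr0 og_leD // nneg_ge0. Qed.
Definition nnegD (a b : nneg Phi) := NNeg (nnegD_subproof a b).

Fact nnegDA : associative nnegD.
Proof. by move=> a b c; apply/val_inj; rewrite /= addrA. Qed.
Fact nneg0D : left_id nneg0 nnegD.
Proof. by move=> a; apply/val_inj; rewrite /= add0r. Qed.
Fact nnegD0 : right_id nneg0 nnegD.
Proof. by move=> a; apply/val_inj; rewrite /= addr0. Qed.
Fact nnegDC : commutative nnegD.
Proof. by move=> a b; apply/val_inj; rewrite /= addrC. Qed.
Fact nnegD_eq0 a b : nnegD a b = nneg0 -> a = nneg0 /\ b = nneg0.
Proof.
move=> /(congr1 val)/= ab0.
suff a0 : (a : Phi) = 0.
  by split; apply/val_inj => //=; rewrite a0 add0r in ab0.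
apply/le_anti; rewrite nneg_ge0 andbT -ab0 -[leLHS]addr0.
by rewrite og_leD // nneg_ge0.
Qed.

HB.instance Definition _ :=
  Choice_isMonomialDef.Build (nneg Phi) nnegDA nneg0D nnegD0 nnegD_eq0.
HB.instance Definition _ := MonomialDef_isConomialDef.Build (nneg Phi) nnegDC.

Lemma nneg_mulE (a b : nneg Phi) : (mmul a b : Phi) = (a : Phi) + (b : Phi).
Proof. by []. Qed.

End NNeg.

Section Ideals.
Variable A : comNzRingType.
Implicit Types (m J S : set A) (x : A).

Definition ideal J : Prop :=
  [/\ J 0, forall x y, J x -> J y -> J (x + y)
         & forall a x, J x -> J (a * x)].

Definition ideal_gen S : set A := smallest ideal S.

Definition noetherian : Prop :=
  forall J, ideal J -> exists s : seq A, J = ideal_gen [set` s].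

Definition maximal_ideal J : Prop :=
  [/\ ideal J, ~ J 1
    & forall J', ideal J' -> J `<=` J' -> ~ J' 1 -> J' = J].

Definition local_ring m : Prop := forall J, maximal_ideal J <-> J = m.

Fixpoint ideal_exp m n : set A :=
  if n is n'.+1 then ideal_gen [set a * b | a in m & b in ideal_exp m n']
  else setT.

Definition adic_complete m : Prop :=
  (forall x, (forall n, ideal_exp m n x) -> x = 0) /\
  forall u : nat -> A,
    (forall n, exists N, forall p q, (N <= p)%N -> (N <= q)%N ->
       ideal_exp m n (u p - u q)) ->
    exists l, forall n, exists N, forall p, (N <= p)%N ->
       ideal_exp m n (u p - l).

(* A and A/m have the same characteristic. *)
Definition equicharacteristic m : Prop :=
  forall p : nat, p \in [pchar A] <-> prime p /\ m p%:R.

(* The composite k -> A -> A/m is bijective. *)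
Definition field_of_representatives m (k : fieldType)
    (iota : {rmorphism k -> A}) : Prop :=
  forall x, exists! c, m (x - iota c).

End Ideals.

(* fge a and fgt a stand for P_a and P_a^+, with a in Phi_{>=0}. *)
Record filtration (Phi : orderedGroupType) (A : comNzRingType) := Filtration {
  fge : nneg Phi -> set A;
  fgt : nneg Phi -> set A;
  fge0 : forall a, fge a 0;
  fgeB : forall a x y, fge a x -> fge a y -> fge a (x - y);
  fgt0 : forall a, fgt a 0;
  fgtB : forall a x y, fgt a x -> fgt a y -> fgt a (x - y);
  fgtW : forall a, fgt a `<=` fge a;
  fge_fgt : forall a b : nneg Phi, (a : Phi) < (b : Phi) -> fge b `<=` fgt a;
  fge1 : fge mone 1;
  fgtN1 : ~ fgt mone 1;
  fgeM : forall a b x y, fge a x -> fge b y -> fge (mmul a b) (x * y);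
  fgtM : forall a b x y, fgt a x -> fge b y -> fgt (mmul a b) (x * y)
}.

Section FiltrationTheory.
Variables (Phi : orderedGroupType) (A : comNzRingType) (F : filtration Phi A).

Lemma fgeD a x y : fge F a x -> fge F a y -> fge F a (x + y).
Proof.
move=> Fx Fy; rewrite -[y]opprK; apply: fgeB => //.
by rewrite -sub0r; apply: fgeB => //; exact: fge0.
Qed.

Lemma fgtD a x y : fgt F a x -> fgt F a y -> fgt F a (x + y).
Proof.
move=> Fx Fy; rewrite -[y]opprK; apply: fgtB => //.
by rewrite -sub0r; apply: fgtB => //; exact: fgt0.
Qed.

Lemma fgt_le (a b : nneg Phi) : (a : Phi) <= (b : Phi) -> fgt F b `<=` fgt F a.
Proof.
rewrite le_eqVlt => /predU1P[/val_inj -> //|ab].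
by apply: subset_trans (fge_fgt ab); exact: fgtW.
Qed.

(* The Rees algebra (+)_phi P_phi t^phi. *)
Definition rees_pred : pred {malg A[nneg Phi]} :=
  fun x => `[< forall a, fge F a x@_a >].

Fact rees_subring_closed : subring_closed rees_pred.
Proof.
split=> [|x y /asboolP xF /asboolP yF|x y /asboolP xF /asboolP yF].
- apply/asboolP => a; rewrite mcoeff1; case: eqP => [->|_].
    exact: fge1.
  exact: fge0.
- by apply/asboolP => a; rewrite mcoeffB; apply: fgeB.
- apply/asboolP => a; rewrite mcoeffMl.
  elim/big_ind: _ => [|u v|b _]; [exact: fge0|exact: fgeD|].
  elim/big_ind: _ => [|u v|c _]; [exact: fge0|exact: fgeD|].
  case: eqP => [<-|_]; last exact: fge0.
  exact: fgeM.
Qed.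

HB.instance Definition _ :=
  GRing.isSubringClosed.Build _ rees_pred rees_subring_closed.

Record rees := Rees { rees_val :> {malg A[nneg Phi]}; reesP : rees_pred rees_val }.
HB.instance Definition _ := [isSub for rees_val].
HB.instance Definition _ := [Choice of rees by <:].
HB.instance Definition _ := [SubChoice_isSubComNzRing of rees by <:].

(* The ideal (+)_phi P_phi^+ t^phi of the Rees algebra. *)
Definition rees_plus : pred rees := fun x => `[< forall a, fgt F a (val x)@_a >].

Fact rees_plus_idealr_closed : idealr_closed rees_plus.
Proof.
split=> [||x u v /asboolP uF /asboolP vF].
- by apply/asboolP => a; rewrite !raddf0; exact: fgt0.
- apply/asboolP => /(_ mone); rewrite !rmorph1.
  exact: fgtN1.
- apply/asboolP => a; rewrite rmorphD rmorphM mcoeffD; apply: fgtD => //.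
  rewrite mulrC mcoeffMl.
  elim/big_ind: _ => [|s t|b _]; [exact: fgt0|exact: fgtD|].
  elim/big_ind: _ => [|s t|c _]; [exact: fgt0|exact: fgtD|].
  case: eqP => [<-|_]; last exact: fgt0.
  by apply: fgtM => //; case: (x) => /= z /asboolP.
Qed.

HB.instance Definition _ :=
  isIdealr.Build rees rees_plus rees_plus_idealr_closed.

(* gr_F A = (+)_phi P_phi / P_phi^+. *)
Definition gr : Type := {ideal_quot (rees_plus : idealr rees)}.
HB.instance Definition _ := GRing.ComNzRing.on gr.

End FiltrationTheory.

Section GradedRing.
Variables (Phi : orderedGroupType) (A : comNzRingType) (F : filtration Phi A).

Definition gr_pi (x : rees F) : gr F := \pi_(gr F)%qT x.

(* The class of x in P_a / P_a^+, as an element of gr (0 if x is not in P_a). *)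
Definition gr_class (a : nneg Phi) (x : A) : gr F :=
  gr_pi (insubd 0 << x *g a >>).

Definition homogeneous (a : nneg Phi) (y : gr F) : Prop :=
  exists2 x, fge F a x & y = gr_class a x.

Definition initial_form (x : A) (y : gr F) : Prop :=
  exists a, [/\ fge F a x, ~ fgt F a x & y = gr_class a x].

Definition gr_scalar (k : fieldType) (s : k -> A) (c : k) : gr F :=
  gr_class mone (s c).

Definition initial_ideal (J : set A) : set (gr F) :=
  ideal_gen [set y | exists2 x, J x & initial_form x y].

End GradedRing.

Arguments homogeneous {Phi A} F a y.
Arguments initial_form {Phi A} F x y.
Arguments initial_ideal {Phi A} F J.

Section GradedMap.
Variables (Phi : orderedGroupType) (A B : comNzRingType).
Variables (F : filtration Phi A) (G : filtration Phi B) (f : A -> B).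

Definition filtered_map : Prop :=
  (forall a x, fge F a x -> fge G a (f x)) /\
  (forall a x, fgt F a x -> fgt G a (f x)).

(* The map gr_F A -> gr_G B induced on each P_phi / P_phi^+ by an additive
   filtered map f. *)
Definition gr_map (y : gr F) : gr G :=
  let x := val (repr y) in
  gr_pi (insubd (0 : rees G) [malg a in msupp x => f x@_a]).

End GradedMap.

Arguments filtered_map {Phi A B} F G f.
Arguments gr_map {Phi A B} F G f y.

(* A neighbourhood of x contains some x + P_phi^+. By nbhs_filteredE below one
   may use x + P_phi instead, unless Phi = 0, where the P_phi^+ still give the
   expected (discrete) topology of a trivial valuation. *)
Definition filtered Phi A (F : filtration Phi A) : Type := A.

Section FilteredTopology.
Variables (Phi : orderedGroupType) (A : comNzRingType) (F : filtration Phi A).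

HB.instance Definition _ := Choice.copy (filtered F) A.

Definition filtered_nbhs (x : filtered F) : set_system (filtered F) :=
  [set V | exists a, forall y : A, fgt F a (y - (x : A)) -> V y].

HB.instance Definition _ := hasNbhs.Build (filtered F) filtered_nbhs.

Fact filtered_nbhs_proper x : ProperFilter (filtered_nbhs x).
Proof.
apply: Build_ProperFilter_ex => [V [a Va]|].
  by exists x; apply: Va; rewrite subrr; exact: fgt0.
split=> [|V W [a Va] [b Wb]|V W VW [a Va]].
- by exists mone.
- have [ab|ba] := orP (og_total (a : Phi) (b : Phi)).
    exists b => y yb; split; [apply: Va|exact: Wb].
    exact: fgt_le yb.
  exists a => y ya; split; [exact: Va|apply: Wb].
  exact: fgt_le ya.
- by exists a => y /Va /VW.
Qed.

Fact filtered_nbhs_singleton x V : filtered_nbhs x V -> V x.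
Proof. by case=> a; apply; rewrite subrr; exact: fgt0. Qed.

Fact filtered_nbhs_nbhs x V :
  filtered_nbhs x V -> filtered_nbhs x (filtered_nbhs^~ V).
Proof.
case=> a Va; exists a => y yx; exists a => z zy; apply: Va.
by rewrite -(subrKA (y : A)); exact: fgtD.
Qed.

HB.instance Definition _ := Nbhs_isNbhsTopological.Build (filtered F)
  filtered_nbhs_proper filtered_nbhs_singleton filtered_nbhs_nbhs.

Lemma nbhs_filteredE (e : Phi) (x : filtered F) (V : set (filtered F)) :
  e != 0 ->
  nbhs x V <-> exists a, forall y : A, fge F a (y - (x : A)) -> V y.
Proof.
move=> e0; split=> [[a Va]|[a Va]]; last first.
  by exists a => y /fgtW/Va.
have [b b0] : exists b : Phi, 0 < b.
  have [e_ge0|e_le0] := orP (og_total 0 e).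
    by exists e; rewrite lt_neqAle eq_sym e0.
  exists (- e); rewrite lt_neqAle eq_sym oppr_eq0 e0 /=.
  by have := og_leD2r (- e) _ _ e_le0; rewrite subrr add0r.
exists (mmul a (NNeg (ltW b0))) => y yab; apply: Va; apply: fge_fgt yab.
by rewrite nneg_mulE /= addrC -[ltLHS]add0r; exact: og_ltD2r.
Qed.

End FilteredTopology.

(* The value of val_fun at 0 is irrelevant. *)
Record valuation (K : fieldType) (Phi : orderedGroupType) := Valuation {
  val_fun :> K -> Phi;
  valM : forall x y, x != 0 -> y != 0 -> val_fun (x * y) = val_fun x + val_fun y;
  valD : forall x y, x != 0 -> y != 0 -> x + y != 0 ->
    Num.min (val_fun x) (val_fun y) <= val_fun (x + y);
  val_surj : forall a, exists2 x, x != 0 & val_fun x = a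
}.

Section Valuations.
Variables (K : fieldType) (Phi : orderedGroupType) (nu : valuation K Phi).

Definition val_ge (a : Phi) : set K := [set x | x = 0 \/ a <= nu x].
Definition val_gt (a : Phi) : set K := [set x | x = 0 \/ a < nu x].

Lemma val1 : nu 1 = 0.
Proof.
apply: (addrI (nu 1)); rewrite -valM ?oner_neq0 // mulr1.
by rewrite addr0.
Qed.

Lemma valN x : nu (- x) = nu x.
Proof.
have [->|x0] := eqVneq x 0; first by rewrite oppr0.
have N1 : (-1 : K) != 0 by rewrite oppr_eq0 oner_neq0.
rewrite -mulN1r valM //.
have NN : nu (-1) + nu (-1) = 0 by rewrite -valM // mulrNN mulr1 val1.
suff -> : nu (-1) = 0 by rewrite add0r.
apply/le_anti; have [h|h] := orP (og_total 0 (nu (-1))); rewrite h ?andbT /=.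
  by have := og_leD2r (nu (-1)) _ _ h; rewrite NN add0r.
by have := og_leD2r (nu (-1)) _ _ h; rewrite NN add0r.
Qed.

Lemma val_ge_neq0 a x : x != 0 -> val_ge a x -> a <= nu x.
Proof. by move=> /eqP x0 []. Qed.

Lemma val_gt_neq0 a x : x != 0 -> val_gt a x -> a < nu x.
Proof. by move=> /eqP x0 []. Qed.

Lemma val_geD a x y : val_ge a x -> val_ge a y -> val_ge a (x + y).
Proof.
have [->|x0] := eqVneq x 0; first by rewrite add0r.
have [->|y0] := eqVneq y 0; first by rewrite addr0.
have [->|xy0] := eqVneq (x + y) 0; first by left.
move=> /(val_ge_neq0 x0) ax /(val_ge_neq0 y0) ay; right.
by apply: le_trans (valD nu x0 y0 xy0); rewrite minElt; case: ifP.
Qed.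

Lemma val_gtD a x y : val_gt a x -> val_gt a y -> val_gt a (x + y).
Proof.
have [->|x0] := eqVneq x 0; first by rewrite add0r.
have [->|y0] := eqVneq y 0; first by rewrite addr0.
have [->|xy0] := eqVneq (x + y) 0; first by left.
move=> /(val_gt_neq0 x0) ax /(val_gt_neq0 y0) ay; right.
by apply: lt_le_trans (valD nu x0 y0 xy0); rewrite minElt; case: ifP.
Qed.

Lemma val_geN a x : val_ge a x -> val_ge a (- x).
Proof. by case=> [->|]; [left; rewrite oppr0|right; rewrite valN]. Qed.

Lemma val_gtN a x : val_gt a x -> val_gt a (- x).
Proof. by case=> [->|]; [left; rewrite oppr0|right; rewrite valN]. Qed.

Lemma val_geM a b x y : val_ge a x -> val_ge b y -> val_ge (a + b) (x * y).
Proof.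
have [->|x0] := eqVneq x 0; first by left; rewrite mul0r.
have [->|y0] := eqVneq y 0; first by left; rewrite mulr0.
move=> /(val_ge_neq0 x0) ax /(val_ge_neq0 y0) ay; right.
by rewrite valM // og_leD.
Qed.

Lemma val_gtM a b x y : val_gt a x -> val_ge b y -> val_gt (a + b) (x * y).
Proof.
have [->|x0] := eqVneq x 0; first by left; rewrite mul0r.
have [->|y0] := eqVneq y 0; first by left; rewrite mulr0.
move=> /(val_gt_neq0 x0) ax /(val_ge_neq0 y0) ay; right.
by rewrite valM // og_ltleD.
Qed.

Definition valuation_ring : set K := val_ge 0.
Definition valuation_ideal : set K := val_gt 0.

End Valuations.

Section ValuationsOnDomain.
Variables (R : idomainType) (Phi : orderedGroupType).
Variable nu : valuation {fraction R} Phi.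
Implicit Types m : set R.

Definition dominates m : Prop :=
  (forall x : R, valuation_ring nu (tofrac x)) /\
  (forall x : R, m x <-> valuation_ideal nu (tofrac x)).

(* R/m -> R_nu/m_nu is onto. *)
Definition rational : Prop :=
  forall y, valuation_ring nu y ->
    exists x : R, valuation_ideal nu (y - tofrac x).

Program Definition val_filtration : filtration Phi R :=
  @Filtration Phi R
    (fun a => [set x | val_ge nu a (tofrac x)])
    (fun a => [set x | val_gt nu a (tofrac x)])
    _ _ _ _ _ _ _ _ _ _.
Next Obligation. by move=> a; left; rewrite rmorph0. Qed.
Next Obligation.
by move=> a x y ax ay; rewrite /= rmorphB; apply: val_geD => //; exact: val_geN.
Qed.
Next Obligation. by move=> a; left; rewrite rmorph0. Qed.
Next Obligation.
by move=> a x y ax ay; rewrite /= rmorphB; apply: val_gtD => //; exact: val_gtN.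
Qed.
Next Obligation. by move=> a x []; [left|move=> /ltW; right]. Qed.
Next Obligation.
by move=> a b ab x []; [left|move=> /(lt_le_trans ab); right].
Qed.
Next Obligation. by right; rewrite rmorph1 val1. Qed.
Next Obligation.
rewrite /= rmorph1; case=> [/eqP|]; first by rewrite oner_eq0.
by rewrite val1 ltxx.
Qed.
Next Obligation. by move=> a b x y ax ay; rewrite /= rmorphM; exact: val_geM. Qed.
Next Obligation. by move=> a b x y ax ay; rewrite /= rmorphM; exact: val_gtM. Qed.

End ValuationsOnDomain.

Section Evaluation.
Variables (I : choiceType) (k : fieldType) (A : comNzRingType).
Variables (s : k -> A) (x : I -> A).

Definition mon_eval (e : {cmonom I}) : A := \prod_(i <- finsupp e) x i ^+ e i.

(* The k-algebra map k[(U_i)] -> A, U_i |-> x_i, where A is a k-algebra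
   through s. *)
Definition poly_eval : {malg k[{cmonom I}]} -> A := mmap s mon_eval.

(* The subfamily (x_i)_{i in J} generates the k-algebra A. *)
Definition generates (J : set I) : Prop :=
  forall y : A, exists2 p : {malg k[{cmonom I}]},
    forall e, e \in msupp p -> [set` finsupp e] `<=` J & y = poly_eval p.

Definition minimal_generators : Prop :=
  generates setT /\ forall J, generates J -> J = setT.

End Evaluation.

Section Divisors.
Variable I : choiceType.
Implicit Types e d : {cmonom I}.

Lemma finite_factorizations e :
  finite_set [set p : {cmonom I} * {cmonom I} | mmul p.1 p.2 = e].
Proof.
pose D := [set d : {cmonom I} | exists d', mmul d d' = e].
have finD : finite_set D.
  pose T := {ffun finsupp e -> 'I_(mdeg e).+1}.
  pose g (f : T) : {cmonom I} :=
    [cmonom (oapp (fun j => nat_of_ord (f j)) 0%N (insub i)) | i in finsupp e]%M.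
  apply: (@sub_finite_set _ _ (g @` setT)); last first.
    by apply: finite_image; exact: finite_finset.
  move=> d [d' dd'].
  have dle i : (d i <= e i)%N by rewrite -dd' cmM leq_addr.
  have elt i : (e i < (mdeg e).+1)%N.
    rewrite ltnS; have [ie|] := boolP (i \in finsupp e); last first.
      by rewrite -cmE_neq0 negbK => /eqP ->.
    by rewrite mdegE (big_fsetD1 i) //= leq_addr.
  exists [ffun i : finsupp e => inord (d (val i))] => //.
  apply/eqP/cmP => i; rewrite /g cmE fsfun_fun.
  case: ifPn => [ie|]; last first.
    by rewrite -cmE_eq0 => /eqP ei; apply/eqP; have := dle i; rewrite ei leqn0 eq_sym.
  by rewrite insubT /= ffunE inordK // (leq_ltn_trans (dle i)).
apply: (@sub_finite_set _ _ (D `*` D)); last exact: finite_setX.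
move=> [d d'] /= dd'; split; first by exists d'.
by exists d; rewrite /= mulmC.
Qed.

End Divisors.

(* All formal sums sum_e f(e) u^e, without condition on the set of e such that
   f(e) <> 0. *)
Definition formal_series (k : fieldType) (I : choiceType) : Type := {cmonom I} -> k.

Section Series.
Variables (k : fieldType) (I : choiceType).
Implicit Types (f g h : formal_series k I) (e d : {cmonom I}) (p q : {malg k[{cmonom I}]}).

HB.instance Definition _ := GRing.Zmodule.copy (formal_series k I) ({cmonom I} -> k).

Definition smon e : formal_series k I := fun d => (d == e)%:R.
Definition svar (i : I) : formal_series k I := smon (ucm i).
Definition sscale (c : k) f : formal_series k I := fun e => c * f e.

Definition sone : formal_series k I := smon mone.
Definition smul f g : formal_series k I :=
  fun e => \sum_(p \in [set p | mmul p.1 p.2 = e]) f p.1 * g p.2.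

Lemma smulE f g e p q :
  (forall d d', mmul d d' = e -> p@_d = f d /\ q@_d' = g d') ->
  smul f g e = (p * q)@_e.
Proof.
move=> pq; rewrite /smul mcoeffMl.
pose r := [seq x <- [seq (d, d') | d <- msupp p, d' <- msupp q]
             | mmul x.1 x.2 == e].
rewrite (fsbigE r) /=.
- rewrite big_mkcond big_filter big_mkcond /= big_allpairs /=.
  apply: eq_bigr => d _; apply: eq_bigr => d' _.
  case: eqP => // dd'; rewrite mem_set // mulr1n.
  by have [-> ->] := pq _ _ dd'.
- apply: filter_uniq; apply: allpairs_uniq; rewrite ?fset_uniq //.
  by move=> [? ?] [? ?].
- by move=> x /=; rewrite mem_filter => /andP[/eqP].
- move=> [d d'] /= dd'; have [<- <-] := pq _ _ dd'.
  rewrite mem_filter /= dd' eqxx /= => ndd'.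
  have [dp|/mcoeff_outdom ->] := boolP (d \in msupp p); last by rewrite mul0r.
  have [dq|/mcoeff_outdom ->] := boolP (d' \in msupp q); last by rewrite mulr0.
  by case/negP: ndd'; apply/allpairsP; exists (d, d').
Qed.

Definition sdivs e : {fset {cmonom I}} :=
  fset_set (fst @` [set p : {cmonom I} * {cmonom I} | mmul p.1 p.2 = e]).

Lemma mem_sdivs e d : d \in sdivs e <-> exists d', mmul d d' = e.
Proof.
rewrite in_fset_set; last exact/finite_image/finite_factorizations.
by split=> [/set_mem[[a b] /= ab <-]|[d' dd']]; [exists b|
  apply/mem_set; exists (d, d')].
Qed.

Definition strunc e f : {malg k[{cmonom I}]} := [malg d in sdivs e => f d].

Lemma strunc_coeff e f d : (exists d', mmul d d' = e) -> (strunc e f)@_d = f d.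
Proof. by move=> /mem_sdivs de; rewrite mcoeffE de. Qed.

Lemma strunc_l e f d d' : mmul d d' = e -> (strunc e f)@_d = f d.
Proof. by move=> dd'; apply: strunc_coeff; exists d'. Qed.

Lemma strunc_r e f d d' : mmul d d' = e -> (strunc e f)@_d' = f d'.
Proof. by rewrite mulmC; exact: strunc_l. Qed.

Lemma smul_strunc f g e d :
  (exists d', mmul d d' = e) -> smul f g d = (strunc e f * strunc e g)@_d.
Proof.
move=> [d' dd']; apply: smulE => a b ab; split; apply: strunc_coeff.
  by exists (mmul b d'); rewrite mulmA ab.
by exists (mmul a d'); rewrite mulmA (mulmC b) ab.
Qed.

Lemma smul_struncE f g e : smul f g e = (strunc e f * strunc e g)@_e.
Proof. by apply: smul_strunc; exists mone; rewrite mulm1. Qed.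

Fact smulA : associative smul.
Proof.
move=> f g h; apply/funext => e.
rewrite (@smulE f _ e (strunc e f) (strunc e g * strunc e h)); last first.
  move=> d d' dd'; split; first exact: strunc_l dd'.
  by rewrite (@smul_strunc _ _ e) //; exists d; rewrite mulmC.
rewrite (@smulE _ h e (strunc e f * strunc e g) (strunc e h)) ?mulrA //.
move=> d d' dd'; split; last exact: strunc_r dd'.
by rewrite (@smul_strunc _ _ e) //; exists d'.
Qed.

Fact smulC : commutative smul.
Proof. by move=> f g; apply/funext => e; rewrite !smul_struncE mulrC. Qed.

Fact smul1s : left_id sone smul.
Proof.
move=> f; apply/funext => e.
rewrite (@smulE _ _ e 1 (strunc e f)) ?mul1r.
  by apply: strunc_coeff; exists mone; rewrite mulm1.
move=> d d' dd'; split; last exact: strunc_r dd'.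
by rewrite mcoeff1.
Qed.

Fact smulDl : left_distributive smul +%R.
Proof.
move=> f g h; apply/funext => e.
rewrite (@smulE _ _ e (strunc e f + strunc e g) (strunc e h)).
  rewrite mulrDl mcoeffD; transitivity (smul f h e + smul g h e) => //.
  by rewrite (smul_struncE f h) (smul_struncE g h).
move=> d d' dd'; split; last exact: strunc_r dd'.
by rewrite mcoeffD !(strunc_l _ dd').
Qed.

Fact sone_neq0 : sone != 0.
Proof.
apply/eqP => /(congr1 (fun f : formal_series k I => f mone)).
by rewrite /sone /smon eqxx => /eqP; rewrite oner_eq0.
Qed.

HB.instance Definition _ := GRing.Zmodule_isComNzRing.Build (formal_series k I)
  smulA smulC smul1s smulDl sone_neq0.

Fact sscaleA a b f : sscale a (sscale b f) = sscale (a * b) f.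
Proof. by apply/funext => e; rewrite /sscale mulrA. Qed.
Fact sscale1 : left_id 1 sscale.
Proof. by move=> f; apply/funext => e; rewrite /sscale mul1r. Qed.
Fact sscaleDr : right_distributive sscale +%R.
Proof. by move=> a f g; apply/funext => e; exact: mulrDr. Qed.
Fact sscaleDl f : {morph sscale^~ f : a b / a + b}.
Proof. by move=> a b; apply/funext => e; exact: mulrDl. Qed.

HB.instance Definition _ := GRing.Zmodule_isLmodule.Build k (formal_series k I)
  sscaleA sscale1 sscaleDr sscaleDl.

Fact sscaleAl a f g : a *: (f * g) = (a *: f) * g.
Proof.
apply/funext => e; change (a * smul f g e = smul (sscale a f) g e).
rewrite [RHS](@smulE _ _ e (a *: strunc e f) (strunc e g)).
  by rewrite -scalerAl mcoeffZ (smul_struncE f g).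
move=> d d' dd'; split; last exact: strunc_r dd'.
by rewrite mcoeffZ (strunc_l _ dd').
Qed.

HB.instance Definition _ :=
  GRing.Lmodule_isLalgebra.Build k (formal_series k I) sscaleAl.
HB.instance Definition _ := GRing.Lalgebra_isComAlgebra.Build k (formal_series k I).

End Series.

Section Weights.
Variables (k : fieldType) (I : choiceType) (Phi : orderedGroupType).
Variable gamma : I -> nneg Phi.
Implicit Types (e d : {cmonom I}) (f g : formal_series k I).

Definition weight e : Phi := \sum_(i <- finsupp e) (gamma i : Phi) *+ e i.

Lemma weightE (D : {fset I}) e : (finsupp e `<=` D)%fset ->
  weight e = \sum_(i <- D) (gamma i : Phi) *+ e i.
Proof.
move=> eD; rewrite /weight (big_fset_incl _ eD) // => i _.
by rewrite -cmE_eq0 => /eqP ->.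
Qed.

Lemma weight1 : weight mone = 0.
Proof. by rewrite /weight mdom1 big_seq_fset0. Qed.

Lemma weightM e d : weight (mmul e d) = weight e + weight d.
Proof.
rewrite {1}/weight mdomD (weightE (fsubsetUl _ (finsupp d))).
rewrite (weightE (fsubsetUr (finsupp e) _)) -big_split /=.
by apply: eq_bigr => i _; rewrite cmM mulrnDr.
Qed.

(* The weight of a series is the least weight of its terms, so these are the
   series of weight >= a and > a. *)
Definition weight_ge (a : Phi) : set (formal_series k I) :=
  [set f | forall e, f e != 0 -> a <= weight e].
Definition weight_gt (a : Phi) : set (formal_series k I) :=
  [set f | forall e, f e != 0 -> a < weight e].

Lemma series_mul_neq0 f g e : (f * g : formal_series k I) e != 0 ->
  exists d d', [/\ mmul d d' = e, f d != 0 & g d' != 0].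
Proof.
apply: contra_neqP => H; rewrite [LHS]fsbig1 // => -[d d'] /= dd'.
have [->|fd] := eqVneq (f d) 0; first by rewrite mul0r.
have [->|gd] := eqVneq (g d') 0; first by rewrite mulr0.
by case: H; exists d, d'.
Qed.

Lemma series_sub_neq0 f g e : (f - g : formal_series k I) e != 0 ->
  f e != 0 \/ g e != 0.
Proof.
move=> fge; apply/orP; rewrite -negb_and; apply: contraNN fge.
move=> /andP[/eqP fe /eqP ge]; apply/eqP.
by change (f e - g e = 0); rewrite fe ge subrr.
Qed.

Program Definition weight_filtration : filtration Phi (formal_series k I) :=
  @Filtration Phi (formal_series k I)
    (fun a => weight_ge a) (fun a => weight_gt a) _ _ _ _ _ _ _ _ _ _.
Next Obligation. by move=> a e /eqP. Qed.
Next Obligation. by move=> a f g Ff Fg e /series_sub_neq0[/Ff|/Fg]. Qed.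
Next Obligation. by move=> a e /eqP. Qed.
Next Obligation. by move=> a f g Ff Fg e /series_sub_neq0[/Ff|/Fg]. Qed.
Next Obligation. by move=> a f Ff e /Ff/ltW. Qed.
Next Obligation. by move=> a b ab f Ff e /Ff/(lt_le_trans ab). Qed.
Next Obligation.
move=> e; change (1 e) with (smon k (mone : {cmonom I}) e); rewrite /smon.
by have [->|_] := eqVneq e mone; rewrite ?weight1 ?lexx // eqxx.
Qed.
Next Obligation.
move=> /(_ mone); change (1 mone) with (smon k (mone : {cmonom I}) mone).
by rewrite /smon eqxx oner_neq0 weight1 ltxx => /(_ isT).
Qed.
Next Obligation.
move=> a b f g Ff Fg e /series_mul_neq0[d [d' [<- /Ff da /Fg db]]].
by rewrite weightM og_leD.
Qed.
Next Obligation.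
move=> a b f g Ff Fg e /series_mul_neq0[d [d' [<- /Ff da /Fg db]]].
by rewrite weightM og_ltleD.
Qed.

(* The k-algebra map k[(U_i)] -> gr_w k[[(u_i)]] sending U_i to the initial
   form of u_i; it is the identification of k[(U_i)] with the associated graded
   ring of the weight filtration when there are finitely many monomials of each
   weight. *)
Definition gr_poly : {malg k[{cmonom I}]} -> gr weight_filtration :=
  poly_eval (gr_scalar weight_filtration (fun c => c%:A : formal_series k I))
            (fun i => gr_class weight_filtration (gamma i) (svar k i)).

Definition mbinomial e d (c : k) : {malg k[{cmonom I}]} := << e >> - << c *g d >>.

Definition overweight_deformation (L : Type) (m n : L -> {cmonom I})
    (lam : L -> k) (F : L -> formal_series k I) : Prop :=
  (forall l, weight (m l) = weight (n l) /\
     exists2 h : formal_series k I, weight_gt (weight (m l)) h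
       & F l = smon k (m l) - lam l *: smon k (n l) + h) /\
  initial_ideal weight_filtration (ideal_gen (range F)) =
    gr_poly @` ideal_gen (range (fun l => mbinomial (m l) (n l) (lam l))).

End Weights.

(* Main.v *)
(** Since R is noetherian, the semigroup of values is well ordered, and the
    ideals P_phi and P_phi^+ are closed for the m-adic topology (Krull).  As
    R/m^n has finite length, all but finitely many values are reached in m^n;
    hence, choosing each representative xi_i in the highest possible power of
    m, almost all of them lie in m^n, for every n.  Any formal sum of monomials
    in the xi_i therefore converges m-adically, which defines the map Pi.  It is
    onto by transfinite successive approximation, using one monomial for each
    value.

    For the kernel one takes all the elements of Ker Pi which are overweight
    deformations of a binomial, so that a binomial is deformed in many ways:
    adding to a deformation an element of the kernel of higher weight yields
    another deformation of the same binomial, so the ideal generated by all of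
    them is Ker Pi itself, which is closed. *)
From HB Require Import structures.
Require Import Defs.
From mathcomp Require Import all_boot all_order all_algebra.
From mathcomp Require Import ring_quotient finmap monalg ring.
From mathcomp Require Import boolp classical_sets functions cardinality.
From mathcomp Require Import filter topology_structure.

Set Implicit Arguments.
Unset Strict Implicit.
Unset Printing Implicit Defensive.

Import Order.TTheory GRing.Theory.

Local Open Scope classical_set_scope.
Local Open Scope ring_scope.

(** If [Phi] is not archimedean, a formal series can have infinitely many terms of bounded weight,
    so its convergence cannot come from the valuation, and P_phi^+ contains in general no power of
    [m]. The bridge between the two topologies is that P_phi and P_phi^+ are [m]-adically closed.
    This is used to bound the powers of [m] that reach a given initial form, so that a deepest
    representative exists; to see that the limit map respects the filtrations; and to show that only
    finitely many monomials have a given weight. By this last fact the homogeneous parts of a series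
    are polynomials, and relations between initial forms can be handled by finite induction.
    Minimality of the generators enters as irredundancy: their degrees are positive and distinct, so
    finitely many exceptional values mean finitely many exceptional indices. Surjectivity is proved
    with a lower bound on the weight of the lift. Applied to the value in R of a binomial, it yields
    a correction that is automatically overweight. *)

Section IdealTheory.
Variable A : comNzRingType.
Implicit Types (J K L m S : set A) (a x y : A).

Lemma ideal0 J : ideal J -> J 0. Proof. by case. Qed.

Lemma idealD J x y : ideal J -> J x -> J y -> J (x + y).
Proof. by case=> _ + _; apply. Qed.

Lemma ideal_mull J a x : ideal J -> J x -> J (a * x).
Proof. by case=> _ _; apply. Qed.

Lemma ideal_mulr J a x : ideal J -> J x -> J (x * a).
Proof. by rewrite mulrC; exact: ideal_mull. Qed.

Lemma idealN J x : ideal J -> J x -> J (- x).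
Proof. by move=> iJ Jx; rewrite -mulN1r; exact: ideal_mull. Qed.

Lemma idealB J x y : ideal J -> J x -> J y -> J (x - y).
Proof. by move=> iJ Jx Jy; apply: idealD => //; exact: idealN. Qed.

Lemma ideal_sum J (T : Type) (r : seq T) (P : pred T) (F : T -> A) :
  ideal J -> (forall t, P t -> J (F t)) -> J (\sum_(t <- r | P t) F t).
Proof.
by move=> iJ JF; elim/big_ind: _ => // [|x y]; [exact: ideal0|exact: idealD].
Qed.

Lemma ideal_gen_ideal S : ideal (ideal_gen S).
Proof.
split=> [|x y Sx Sy|a x Sx] J [iJ SJ]; first exact: ideal0.
  by apply: idealD => //; [exact: Sx|exact: Sy].
by apply: ideal_mull => //; exact: Sx.
Qed.

Lemma sub_ideal_gen S : S `<=` ideal_gen S.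
Proof. exact: sub_gen_smallest. Qed.

Lemma ideal_gen_sub S J : ideal J -> S `<=` J -> ideal_gen S `<=` J.
Proof. by move=> iJ SJ x; apply. Qed.

Lemma noetherian_stable (J : nat -> set A) : noetherian A ->
  (forall n, ideal (J n)) -> (forall n, J n `<=` J n.+1) ->
  exists n, J n.+1 `<=` J n.
Proof.
move=> noeA iJ JS.
have Jle p q : (p <= q)%N -> J p `<=` J q.
  by move=> /subnKC <-; elim: (q - p)%N => [|d IH]; rewrite ?addn0 ?addnS //;
    apply: subset_trans IH _; exact: JS.
have iU : ideal (\bigcup_n J n).
  split=> [|x y [p _ Jx] [q _ Jy]|a x [p _ Jx]].
  - by exists 0 => //; exact: ideal0.
  - exists (maxn p q) => //; apply: idealD => //.
      by apply: Jle Jx; exact: leq_maxl.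
    by apply: Jle Jy; exact: leq_maxr.
  - by exists p => //; exact: ideal_mull.
have [s sU] := noeA _ iU.
have [n sn] : exists n, [set` s] `<=` J n.
  have : [set` s] `<=` \bigcup_n J n by rewrite sU; exact: sub_ideal_gen.
  elim: s {sU} => [_|a s IH sU]; first by exists 0.
  have [|p sp] := IH; first by move=> x xs; apply: sU; rewrite /= in_cons xs orbT.
  have [|q _ aq] := sU a; first by rewrite /= in_cons eqxx.
  exists (maxn p q) => x /=; rewrite in_cons => /predU1P[->|xs].
    by apply: Jle aq; exact: leq_maxr.
  by apply: Jle (sp _ xs); exact: leq_maxl.
exists n; apply: (@subset_trans _ (\bigcup_n J n)); first by move=> x Jx; exists n.+1.
by rewrite sU; apply: ideal_gen_sub.
Qed.

(** Iterating a choice of strictly larger ideals would contradict [noetherian_stable]. Krull's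
    theorem and the well-ordering of the values both rest on this form of noetherianity. *)
Lemma noetherian_max (P : set A -> Prop) J : noetherian A ->
  ideal J -> P J ->
  exists L, [/\ ideal L, P L & forall K, ideal K -> P K -> L `<=` K -> K `<=` L].
Proof.
move=> noeA iJ PJ; apply: contrapT => noL.
have /choice[f fP] K : exists K', ideal K /\ P K ->
    [/\ ideal K', P K', K `<=` K' & ~ K' `<=` K].
  have [[iK PK]|nK] := pselect (ideal K /\ P K); last by exists K => /nK.
  apply: contrapT => noK; apply: noL; exists K; split=> // K' iK' PK' KK'.
  by apply: contrapT => K'K; apply: noK; exists K'.
pose s n := iter n f J.
have sP n : ideal (s n) /\ P (s n) by elim: n => //= n /fP[].
have [|n|n] := noetherian_stable noeA (J := s); first by move=> n; case: (sP n).
  by have [] := fP _ (sP n).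
by have [] := fP _ (sP n).
Qed.

Lemma ideal_colon J a : ideal J -> ideal [set r | J (r * a)].
Proof.
move=> iJ; split=> /= [|x y xJ yJ|b x xJ].
- by rewrite mul0r; exact: ideal0.
- by rewrite mulrDl; exact: idealD.
- by rewrite -mulrA; exact: ideal_mull.
Qed.

(** The ideal [J + (a)]. *)
Definition ideal_adjoin J a : set A := [set x | exists r, J (x - r * a)].

Lemma ideal_adjoin_ideal J a : ideal J -> ideal (ideal_adjoin J a).
Proof.
move=> iJ; split=> [|x y [r Jx] [s Jy]|b x [r Jx]].
- by exists 0; rewrite mul0r subrr; exact: ideal0.
- by exists (r + s); rewrite mulrDl opprD addrACA; exact: idealD.
- by exists (b * r); rewrite -mulrA -mulrBr; exact: ideal_mull.
Qed.

Lemma sub_ideal_adjoin J a : J `<=` ideal_adjoin J a.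
Proof. by move=> x Jx; exists 0; rewrite mul0r subr0. Qed.

Lemma mem_ideal_adjoin J a : ideal J -> ideal_adjoin J a a.
Proof. by exists 1; rewrite mul1r subrr; exact: ideal0. Qed.

Lemma ideal_exp_ideal m n : ideal (ideal_exp m n).
Proof. by case: n => [|n] //=; exact: ideal_gen_ideal. Qed.

Lemma ideal_expS m n a x : m a -> ideal_exp m n x -> ideal_exp m n.+1 (a * x).
Proof. by move=> ma mx; apply: sub_ideal_gen; exists a => //; exists x. Qed.

Lemma ideal_expSW m n : ideal_exp m n.+1 `<=` ideal_exp m n.
Proof.
apply: ideal_gen_sub; first exact: ideal_exp_ideal.
by move=> _ [a _ [x mx <-]]; apply: ideal_mull => //; exact: ideal_exp_ideal.
Qed.

Lemma ideal_exp_le m p q : (p <= q)%N -> ideal_exp m q `<=` ideal_exp m p.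
Proof.
move=> /subnKC <-; elim: (q - p)%N => [|d IH]; rewrite ?addn0 ?addnS //.
exact: subset_trans (@ideal_expSW _ _) IH.
Qed.

Lemma ideal_exp_mul m p q x y :
  ideal_exp m p x -> ideal_exp m q y -> ideal_exp m (p + q) (x * y).
Proof.
elim: p x => [|p IH] x mx my.
  by apply: ideal_mull => //; exact: ideal_exp_ideal.
suff : ideal_exp m p.+1 `<=` [set x | ideal_exp m (p.+1 + q) (x * y)] by apply.
apply: ideal_gen_sub; first exact/ideal_colon/ideal_exp_ideal.
by move=> _ [a ma [z mz <-]]; have := ideal_expS ma (IH _ mz my); rewrite mulrA.
Qed.

(** Testing against an arbitrary ideal [K] lets the induction on [p] pass to the colon ideal
    [(K : a)]: a factor [a] is peeled off a generator and absorbed into the factor from [m^p]. *)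
Lemma ideal_exp_sub m p q K : ideal K ->
    (forall x y, ideal_exp m p x -> ideal_exp m q y -> K (x * y)) ->
  ideal_exp m (p + q) `<=` K.
Proof.
elim: p K => [|p IH] K iK mK; first by move=> y my; rewrite -[y]mul1r; exact: mK.
apply: ideal_gen_sub => // _ [a ma [z mz <-]]; rewrite mulrC.
apply: (IH [set z | K (z * a)]) mz; first exact: ideal_colon.
by move=> x y mx my /=; rewrite mulrC mulrA; apply: mK => //; exact: ideal_expS.
Qed.

(* An ideal P containing no power of m and maximal for this property is prime,
   so that it contains m. *)
Lemma ideal_exp_sub_nilpotent m L : noetherian A -> ideal L ->
  (forall a, m a -> exists n, L (a ^+ n)) -> exists n, ideal_exp m n `<=` L.
Proof.
move=> noeA iL Lnil; apply: contrapT => nL.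
pose bad K := L `<=` K /\ ~ exists n, ideal_exp m n `<=` K.
have [P [iP [LP nP] Pmax]] := @noetherian_max bad L noeA iL (conj (@subset_refl _ L) nL).
have bigger K : ideal K -> P `<=` K -> ~ K `<=` P ->
    exists n, ideal_exp m n `<=` K.
  move=> iK PK KP; apply: contrapT => nK; apply: KP; apply: Pmax => //.
  by split=> //; exact: subset_trans PK.
(* If neither [a] nor [b] is in [P], then [P + (b)] and [(P : b)] properly contain [P], hence
   contain powers of [m]; but their product lies in [P]. *)
have Pprime a b : P (a * b) -> ~ P a -> P b.
  move=> Pab Pa; apply: contrapT => Pb; apply: nP.
  have [||p mp] := bigger _ (ideal_adjoin_ideal b iP); first exact: sub_ideal_adjoin.
    by move=> /(_ _ (mem_ideal_adjoin b iP)).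
  have [||q mq] := bigger _ (ideal_colon b iP); first by move=> x; exact: ideal_mulr.
    by move=> /(_ a Pab).
  exists (p + q)%N; apply: ideal_exp_sub => // x y /mp[r Px] /mq /= Py.
  rewrite -(subrK (r * b) x) mulrDl; apply: idealD => //; first exact: ideal_mulr.
  by rewrite -mulrA (mulrC b); exact: ideal_mull.
apply: nP; exists 1; apply: ideal_gen_sub => // _ [a ma [x _ <-]].
apply: ideal_mulr => //; have [n Ln] := Lnil a ma.
apply: contrapT => Pa; have {Ln} := LP _ Ln.
elim: n => [|n IH] Pan; last by apply: IH; apply: Pprime Pa; rewrite -exprS.
by apply: Pa; rewrite -[a]mulr1; exact: ideal_mull.
Qed.

(* Herstein's form of Krull's intersection theorem: an ideal maximal among
   those which contain J and avoid x contains a power of m. *)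
Lemma closed_of_annihilated m J x : noetherian A -> ideal J ->
  (forall a, m a -> J (a * x)) ->
  (forall n, exists2 y, J y & ideal_exp m n (x - y)) -> J x.
Proof.
move=> noeA iJ mxJ xJ; apply: contrapT => nJx.
have [L [iL [JL nLx] Lmax]] :=
  @noetherian_max (fun K => J `<=` K /\ ~ K x) J noeA iJ (conj (@subset_refl _ J) nJx).
have [a ma|n mL] := ideal_exp_sub_nilpotent (m := m) noeA iL; last first.
  by apply: nLx; have [y Jy /mL Lxy] := xJ n; rewrite -(subrK y x); apply: idealD => //;
    exact: JL.
(* The chain [(L : a^n)] stops growing at some [n]. If [a^n] were not in [L], maximality would put
   [x] in [L + (a^n)], say [x = l + r a^n]; as [a x] is in [L], so is [r a^(n+1)], hence [r a^n],
   hence [x]. *)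
have [||n Ln] := noetherian_stable (J := fun n => [set r | L (r * a ^+ n)]) noeA.
- by move=> n; exact: ideal_colon.
- by move=> n r /= Lr; rewrite exprSr mulrA; exact: ideal_mulr.
exists n; apply: contrapT => nLa.
apply: nLx; have [r Lx] : ideal_adjoin L (a ^+ n) x.
  apply: contrapT => nx; apply: nLa.
  apply: (Lmax _ (ideal_adjoin_ideal _ iL)); last exact: mem_ideal_adjoin.
    by split=> //; apply: subset_trans JL _; exact: sub_ideal_adjoin.
  exact: sub_ideal_adjoin.
rewrite -(subrK (r * a ^+ n) x); apply: idealD => //; apply: Ln => /=.
have -> : r * a ^+ n.+1 = a * x - a * (x - r * a ^+ n).
  by rewrite mulrBr opprB addrC subrK exprS mulrCA.
by apply: idealB => //; [apply: JL; exact: mxJ|exact: ideal_mull].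
Qed.

End IdealTheory.

Section IdealMorphism.
Variables (A B : comNzRingType) (g : {rmorphism A -> B}).

Lemma ideal_preimage J : ideal J -> ideal [set x | J (g x)].
Proof.
move=> iJ; split=> /= [|x y Jx Jy|a x Jx].
- by rewrite rmorph0; exact: ideal0.
- by rewrite rmorphD; exact: idealD.
- by rewrite rmorphM; exact: ideal_mull.
Qed.

Lemma ideal_kernel : ideal [set x | g x = 0].
Proof.
split=> /= [|x y x0 y0|a x x0]; first by rewrite rmorph0.
  by rewrite rmorphD x0 y0 addr0.
by rewrite rmorphM x0 mulr0.
Qed.

Lemma ideal_image J : (forall y, exists x, g x = y) -> ideal J -> ideal (g @` J).
Proof.
move=> gsurj iJ; split=> [|_ _ [x Jx <-] [y Jy <-]|b _ [x Jx <-]].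
- by exists 0; [exact: ideal0|rewrite rmorph0].
- by exists (x + y); [exact: idealD|rewrite rmorphD].
- by have [a <-] := gsurj b; exists (a * x); [exact: ideal_mull|rewrite rmorphM].
Qed.

End IdealMorphism.

(** * Values on a noetherian domain *)

Section OrderedGroupOrder.
Variable Phi : orderedGroupType.
Implicit Types x y : Phi.

Lemma og_leNlt x y : ~ x <= y -> y < x.
Proof.
move=> /negP nxy; have /orP[xy|] := og_total x y; first by rewrite xy in nxy.
by rewrite le_eqVlt => /predU1P[yx|//]; rewrite yx lexx in nxy.
Qed.

Lemma og_ltNle x y : ~ x < y -> y <= x.
Proof.
move=> nxy; apply: contrapT => /og_leNlt yx; exact: nxy.
Qed.

End OrderedGroupOrder.

Section ValuedDomain.
Variables (R : idomainType) (m : set R) (Phi : orderedGroupType).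
Variable nu : valuation {fraction R} Phi.
Hypothesis noeR : noetherian R.
Hypothesis domR : dominates nu m.
Implicit Types (x y z : R) (a b : Phi).

Definition rval x : Phi := nu (tofrac x).
(** Convertible to [fge] of [val_filtration] (and [rgt] to [fgt]), but indexed by all of [Phi],
    which avoids carrying proofs of nonnegativity. *)
Definition rge a : set R := [set x | val_ge nu a (tofrac x)].
Definition rgt a : set R := [set x | val_gt nu a (tofrac x)].

Lemma rge_neq0 a x : x != 0 -> rge a x <-> a <= rval x.
Proof.
move=> x0; split; last by right.
by case=> // /eqP; rewrite tofrac_eq0 (negbTE x0).
Qed.

Lemma rgt_neq0 a x : x != 0 -> rgt a x <-> a < rval x.
Proof.
move=> x0; split; last by right.
by case=> // /eqP; rewrite tofrac_eq0 (negbTE x0).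
Qed.

Lemma rgtN_neq0 a x : ~ rgt a x -> x != 0.
Proof. by move=> nx; apply/eqP => x0; apply: nx; left; rewrite x0 rmorph0. Qed.

Lemma rgeN_neq0 a x : ~ rge a x -> x != 0.
Proof. by move=> nx; apply/eqP => x0; apply: nx; left; rewrite x0 rmorph0. Qed.

Lemma rgt_rge a x : rgt a x -> rge a x.
Proof. by case=> [|/ltW]; [left|right]. Qed.

Lemma rge_rgt a b x : a < b -> rge b x -> rgt a x.
Proof. by move=> ab [|/(lt_le_trans ab)]; [left|right]. Qed.

Lemma rge_le a b x : a <= b -> rge b x -> rge a x.
Proof. by move=> ab [|/(le_trans ab)]; [left|right]. Qed.

Lemma rgt_le a b x : a <= b -> rgt b x -> rgt a x.
Proof. by move=> ab [|/(le_lt_trans ab)]; [left|right]. Qed.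

Lemma rval_rge x : rge (rval x) x.
Proof. by right. Qed.

Lemma rval_rgtN x : x != 0 -> ~ rgt (rval x) x.
Proof. by move=> x0 /(rgt_neq0 _ x0); rewrite ltxx. Qed.

Lemma rval_eq a x : rge a x -> ~ rgt a x -> rval x = a.
Proof.
move=> ax nax; have x0 := rgtN_neq0 nax; apply/le_anti.
by rewrite (rge_neq0 _ x0).1 // andbT; apply/og_ltNle => /(rgt_neq0 _ x0).
Qed.

Lemma rge0 x : rge 0 x.
Proof. by case: domR => + _; apply. Qed.

Lemma rval_ge0 x : x != 0 -> 0 <= rval x.
Proof. by move=> x0; apply/(rge_neq0 _ x0)/rge0. Qed.

Lemma mrgt x : m x <-> rgt 0 x.
Proof. by case: domR => _; apply. Qed.

Lemma rgtD a x y : rgt a x -> rgt a y -> rgt a (x + y).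
Proof. by rewrite /rgt /= rmorphD; exact: val_gtD. Qed.

Lemma rgeM a b x y : rge a x -> rge b y -> rge (a + b) (x * y).
Proof. by rewrite /rge /= rmorphM; exact: val_geM. Qed.

Lemma rgtMl a b x y : rgt a x -> rge b y -> rgt (a + b) (x * y).
Proof. by rewrite /rgt /= rmorphM; exact: val_gtM. Qed.

Lemma rge_ideal a : ideal (rge a).
Proof.
split=> [|x y|b x xa]; first by left; rewrite rmorph0.
  by rewrite /rge /= rmorphD; exact: val_geD.
by rewrite -[a]add0r; apply: rgeM => //; exact: rge0.
Qed.

Lemma rgt_ideal a : ideal (rgt a).
Proof.
split=> [|x y|b x xa]; [by left; rewrite rmorph0|exact: rgtD|].
by rewrite mulrC -[a]addr0; apply: rgtMl => //; exact: rge0.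
Qed.

Lemma rval_subr a x y : rge a x -> ~ rgt a x -> rgt a y ->
  [/\ x - y != 0 & rval (x - y) = a].
Proof.
move=> ax nax ay.
have nxy : ~ rgt a (x - y).
  by move=> xy; apply: nax; rewrite -(subrK y x); exact: rgtD.
split; first exact: rgtN_neq0 nxy.
apply: rval_eq nxy; apply: idealB => //; [exact: rge_ideal|exact: rgt_rge].
Qed.

(** The ideals [rge (rval y)] grow as the value decreases, so a maximal one among them comes from an
    element of least value. *)
Lemma min_rval (S : set R) x : S x -> x != 0 ->
  exists2 y, S y & y != 0 /\ forall z, S z -> z != 0 -> rval y <= rval z.
Proof.
move=> Sx x0.
pose P (J : set R) := exists2 y, S y & y != 0 /\ J = rge (rval y).
have [|L [iL [y Sy [y0 ->]] Lmax]] := @noetherian_max _ P (rge (rval x)) noeR (rge_ideal _).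
  by exists x.
exists y => //; split=> // z Sz z0; apply/og_ltNle => zy.
have : rge (rval y) z; last by move=> /(rge_neq0 _ z0) /(lt_le_trans zy); rewrite ltxx.
apply: (Lmax (rge (rval z)) (rge_ideal _)); [by exists z| |exact: rval_rge].
by move=> w; apply: rge_le; exact: ltW.
Qed.

(** Only the smaller side has to be a value of [R]: this suffices for well-foundedness, while [Phi]
    itself need not be well ordered. *)
Definition value_lt a b : Prop := a < b /\ exists2 x, x != 0 & rval x = a.

Lemma value_lt_wf : well_founded value_lt.
Proof.
move=> b; apply: contrapT => nb.
have [x x0 nx] : exists2 x, x != 0 & ~ Acc value_lt (rval x).
  apply: contrapT => nex; apply: nb; split=> _ [_ [x x0 <-]].
  by apply: contrapT => nx; apply: nex; exists x.
have [y ny [y0 ymin]] := @min_rval (fun x => ~ Acc value_lt (rval x)) x nx x0.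
apply: ny; split=> w [zy [z z0 zE]]; apply: contrapT; rewrite -zE => nz.
by have := lt_le_trans zy (ymin _ nz z0); rewrite zE ltxx.
Qed.

(** Otherwise the value [v] of [x] is at most [a]. Elements of [m] have positive value, so [m x]
    lies in [rgt v]; then [closed_of_annihilated] puts [x] in [rgt v], which is absurd. *)
Lemma rgt_closed a x :
  (forall n, exists2 y, rgt a y & ideal_exp m n (x - y)) -> rgt a x.
Proof.
move=> xa; apply: contrapT => nax; have x0 := rgtN_neq0 nax.
have le_xa : rval x <= a by apply/og_ltNle => /(rgt_neq0 _ x0).
apply: (rval_rgtN x0); apply: (closed_of_annihilated (m := m) noeR (rgt_ideal _)).
  by move=> b /mrgt mb; rewrite -[rval x]add0r; apply: rgtMl => //; exact: rval_rge.
by move=> n; have [y ay mxy] := xa n; exists y => //; exact: rgt_le ay.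
Qed.

Lemma rge_closed a x :
  (forall n, exists2 y, rge a y & ideal_exp m n (x - y)) -> rge a x.
Proof.
move=> xa; apply: contrapT => nax; have x0 := rgeN_neq0 nax.
have lt_xa : rval x < a by apply: og_leNlt => /(rge_neq0 _ x0).
apply: (rval_rgtN x0); apply: rgt_closed => n.
by have [y ay mxy] := xa n; exists y => //; exact: rge_rgt ay.
Qed.

(** * Rationality, and the values modulo powers of [m] *)

Section Scalars.
Variables (k : fieldType) (iota : {rmorphism k -> R}).
Hypothesis kR : field_of_representatives m iota.
Hypothesis ratR : rational nu.
Implicit Types (c : k).

Lemma iota_mod_m x : exists c, m (x - iota c).
Proof. by have [c [mc _]] := kR x; exists c. Qed.

Lemma rgt_iotaM a c x : c != 0 -> rgt a (iota c * x) -> rgt a x.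
Proof.
move=> c0 cx; rewrite -[x]mul1r -(rmorph1 iota) -(mulVf c0) rmorphM -mulrA.
by apply: ideal_mull => //; exact: rgt_ideal.
Qed.

(** By rationality the quotient [y / x] is congruent to an element of [R], hence to a scalar [c],
    modulo the ideal of the valuation; multiplying back by [x] leaves an error in [rgt a]. *)
Lemma rgt_span1 a x y : rge a x -> ~ rgt a x -> rge a y ->
  exists c, rgt a (y - iota c * x).
Proof.
move=> ax nax ay; have x0 := rgtN_neq0 nax.
have X0 : tofrac x != 0 by rewrite tofrac_eq0.
have yx : valuation_ring nu (tofrac y / tofrac x).
  have [->|y0] := eqVneq y 0; first by left; rewrite rmorph0 mul0r.
  have Y0 : tofrac y != 0 by rewrite tofrac_eq0.
  right; have : nu (tofrac y) = nu (tofrac y / tofrac x) + nu (tofrac x).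
    by rewrite -Defs.valM ?divfK // mulf_neq0 ?invr_eq0.
  rewrite -/(rval x) (rval_eq ax nax) => yE.
  have := (rge_neq0 _ y0).1 ay; rewrite /rval yE => /(og_leD2r (- a)).
  by rewrite subrr addrK.
have [r yr] := ratR yx; have [c /mrgt rc] := iota_mod_m r; exists c.
have yc : val_gt nu 0 (tofrac y / tofrac x - tofrac (iota c)).
  rewrite -(subrKA (tofrac r)); apply: val_gtD => //.
  by move: rc; rewrite /rgt /= rmorphB.
have := val_gtM yc ax; rewrite mulrBl divfK // add0r.
by rewrite /rgt /= rmorphB rmorphM.
Qed.

Lemma rgt_span1_neq0 a x y : rge a x -> ~ rgt a x -> rge a y -> ~ rgt a y ->
  exists2 c, c != 0 & rgt a (y - iota c * x).
Proof.
move=> ax nax ay nay; have [c cxy] := rgt_span1 ax nax ay; exists c => //.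
by apply/eqP => c0; move: cxy; rewrite c0 rmorph0 mul0r subr0.
Qed.

(** The sum of [V] and the [k]-span of [s], built so that each entry of [s] raises the dimension by
    at most one. *)
Fixpoint kspan (V : set R) (s : seq R) : set R :=
  if s is g :: s' then [set x | exists c, kspan V s' (x - iota c * g)] else V.

Lemma kspan_cat V s t : kspan V (s ++ t) = kspan (kspan V t) s.
Proof. by elim: s => //= g s ->. Qed.

Lemma kspanS V W s : V `<=` W -> kspan V s `<=` kspan W s.
Proof. by move=> VW; elim: s => //= g s IH x [c /IH xc]; exists c. Qed.

Lemma kspan_lin V s c x y : ideal V ->
  kspan V s x -> kspan V s y -> kspan V s (x - iota c * y).
Proof.
move=> iV; elim: s x y => [|g s IH] x y /=.
  by move=> Vx Vy; apply: idealB => //; exact: ideal_mull.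
move=> [d xd] [e ye]; exists (d - c * e).
have := IH _ _ xd ye; congr kspan.
by rewrite rmorphB rmorphM /=; ring.
Qed.

Lemma kspan_gen V t : ideal V -> (forall g (a : R), g \in t -> m a -> V (a * g)) ->
  ideal_gen [set` t] `<=` kspan V t.
Proof.
move=> iV Vt.
(* An ideal between is obtained by adjoining the entries of [t] to [V] one by one; a coefficient [r]
   can be replaced by a scalar because [r - iota c] is in [m] and [m t] lies in [V]. *)
suff [J [iJ VJ tJ Jt]] : exists J, [/\ ideal J, V `<=` J, [set` t] `<=` J & J `<=` kspan V t].
  by apply: subset_trans Jt; exact: ideal_gen_sub.
elim: t Vt => [|g t IH] Vt; first by exists V; split.
have [|J [iJ VJ tJ Jt]] := IH.
  by move=> h a ht; apply: Vt; rewrite in_cons ht orbT.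
exists (ideal_adjoin J g); split.
- exact: ideal_adjoin_ideal.
- by apply: subset_trans VJ _; exact: sub_ideal_adjoin.
- move=> h /=; rewrite in_cons => /predU1P[->|ht]; first exact: mem_ideal_adjoin.
  exact/sub_ideal_adjoin/tJ.
move=> x [r Jx]; have [c rc] := iota_mod_m r; exists c; apply: Jt.
rewrite -(subrKA (r * g)) -mulrBl; apply: idealD => //; apply: VJ.
by apply: Vt; rewrite ?in_cons ?eqxx.
Qed.

(** Ideal generators of [m^n] span it over [k] modulo [m^(n+1)]; by induction, [R / m^n] is
    finite-dimensional over [k]. *)
Lemma kspan_ideal_exp n : exists s, forall x, kspan (ideal_exp m n) s x.
Proof.
elim: n => [|n [s IH]]; first by exists [::].
have [t tE] := noeR (ideal_exp_ideal m n); exists (s ++ t) => x.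
rewrite kspan_cat; apply: kspanS (IH x); rewrite [X in X `<=` _]tE.
apply: kspan_gen => [|g a gt ma]; first exact: ideal_exp_ideal.
by apply: ideal_expS => //; rewrite tE; exact: sub_ideal_gen.
Qed.

(* By induction on s: a subspace of codimension at most one misses at most one
   value. *)
Lemma kspan_values V s : ideal V -> exists l : seq Phi, forall x, x != 0 ->
  kspan V s x -> rval x \in l \/ exists y, [/\ V y, y != 0 & rval y = rval x].
Proof.
move=> iV; elim: s => [|g s [l IH]]; first by exists [::] => x x0 Vx; right; exists x.
pose missed x := [/\ kspan V (g :: s) x, x != 0
  & ~ exists y, [/\ kspan V s y, y != 0 & rval y = rval x]].
(* Subtracting from [x] the multiple of [y] that cancels its [g]-component keeps the value of [x],
   as [y] has larger value, and lands in the smaller span. So all missed elements share one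
   value. *)
have reached x y : missed x -> missed y -> ~ rval x < rval y.
  move=> [[c xc] x0 nx] [[d yd] y0 ny] xy.
  have d0 : d != 0.
    apply/eqP => d0; apply: ny; exists y; split=> //.
    by move: yd; rewrite d0 rmorph0 mul0r subr0.
  have [xy0 vxy] : x - iota (c / d) * y != 0 /\ rval (x - iota (c / d) * y) = rval x.
    apply/and_comm; have [] := @rval_subr (rval x) x (iota (c / d) * y) => //.
    - exact: rval_rge.
    - exact: rval_rgtN.
    - by apply: ideal_mull; [exact: rgt_ideal|apply/rgt_neq0].
  apply: nx; exists (x - iota (c / d) * y); split=> //.
  have := kspan_lin (c / d) iV xc yd; congr kspan.
  by rewrite mulrBr mulrA -rmorphM divfK // opprB addrA subrK.
have [[x0 mx0]|nmissed] := pselect (exists x, missed x).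
  exists (rval x0 :: l) => x xn0 xs.
  have [mx|nmx] := pselect (missed x).
    left; rewrite in_cons; apply/orP; left; apply/eqP/le_anti.
    by apply/andP; split; apply/og_ltNle; exact: reached.
  have [y [ys y0 <-]] : exists y, [/\ kspan V s y, y != 0 & rval y = rval x].
    by apply: contrapT => ny; apply: nmx; split.
  by have [yl|] := IH y y0 ys; [left; rewrite in_cons yl orbT|right].
exists l => x xn0 xs.
have [y [ys y0 <-]] : exists y, [/\ kspan V s y, y != 0 & rval y = rval x].
  by apply: contrapT => ny; apply: nmissed; exists x.
exact: IH.
Qed.

Lemma finite_values_mod n : exists l : seq Phi, forall x, x != 0 ->
  rval x \in l \/ exists y, [/\ ideal_exp m n y, y != 0 & rval y = rval x].
Proof.
have [s sP] := kspan_ideal_exp n.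
by have [l lP] := kspan_values s (ideal_exp_ideal m n); exists l => x /lP; apply.
Qed.

End Scalars.

Section Limits.
Hypothesis complR : adic_complete m.
Variable u : nat -> R.
Hypothesis u_cauchy : forall n p, (n <= p)%N -> ideal_exp m n (u p - u n).

Lemma adic_limit : exists l, forall n, ideal_exp m n (u n - l).
Proof.
have [_ /(_ u)[|l lP]] := complR.
  move=> n; exists n => p q np nq; rewrite -(subrKA (u n)).
  apply: idealD; [exact: ideal_exp_ideal|exact: u_cauchy|].
  by rewrite -opprB; apply: idealN; [exact: ideal_exp_ideal|exact: u_cauchy].
exists l => n; have [N NP] := lP n.
rewrite -(subrKA (u (maxn n N))); apply: idealD; first exact: ideal_exp_ideal.
  rewrite -opprB; apply: idealN; first exact: ideal_exp_ideal.
  exact/u_cauchy/leq_maxl.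
exact/NP/leq_maxr.
Qed.

End Limits.

End ValuedDomain.

(** * Associated graded rings *)

Section GradedRingTheory.
Variables (Phi : orderedGroupType) (A : comNzRingType) (F : filtration Phi A).
Implicit Types (a b : nneg Phi) (x y : A) (r : rees F).

Fact gr_pi_zmod_morphism : zmod_morphism (@gr_pi Phi A F).
Proof. by move=> x y; rewrite /gr_pi; exact: (rmorphB (\pi_(gr F)%qT)). Qed.

Fact gr_pi_monoid_morphism : monoid_morphism (@gr_pi Phi A F).
Proof.
split; first exact: (rmorph1 (\pi_(gr F)%qT)).
by move=> x y; exact: (rmorphM (\pi_(gr F)%qT)).
Qed.

HB.instance Definition _ :=
  GRing.isZmodMorphism.Build _ _ (@gr_pi Phi A F) gr_pi_zmod_morphism.
HB.instance Definition _ :=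
  GRing.isMonoidMorphism.Build _ _ (@gr_pi Phi A F) gr_pi_monoid_morphism.

Lemma gr_piP r s : gr_pi r = gr_pi s <-> forall a, fgt F a ((val r)@_a - (val s)@_a).
Proof.
have -> : (gr_pi r = gr_pi s) <-> (r - s \in (rees_plus (F := F) : idealr _)).
  by rewrite Quotient.idealrBE; split=> [/eqP|/eqP].
rewrite unfold_in /rees_plus asboolE; split=> rs a; move: (rs a);
  by rewrite rmorphB mcoeffB.
Qed.

Lemma fge_sum a (T : Type) (l : seq T) (P : pred T) (G : T -> A) :
  (forall t, P t -> fge F a (G t)) -> fge F a (\sum_(t <- l | P t) G t).
Proof. by move=> FG; elim/big_ind: _ => // *; [exact: fge0|exact: fgeD]. Qed.

Lemma rees_predU a x : fge F a x -> rees_pred F << x *g a >>.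
Proof.
move=> ax; apply/asboolP => b; rewrite mcoeffU.
by have [<-|_] := eqVneq a b; rewrite ?mulr1n ?mulr0n //; exact: fge0.
Qed.

Definition reesU a x : rees F := insubd 0 << x *g a >>.

Lemma gr_class_pi a x : gr_class F a x = gr_pi (reesU a x).
Proof. by []. Qed.

Lemma val_reesU a x : fge F a x -> val (reesU a x) = << x *g a >>.
Proof. by move=> /rees_predU ax; rewrite insubdK. Qed.

Lemma gr_classW a x : fge F a x ->
  exists2 r, gr_class F a x = gr_pi r & val r = << x *g a >>.
Proof. by move=> ax; exists (reesU a x); rewrite ?val_reesU. Qed.

Lemma gr_piE r s : val r = val s -> gr_pi r = gr_pi s.
Proof. by move=> /val_inj ->. Qed.

Lemma gr_classP a x y : fge F a x -> fge F a y ->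
  gr_class F a x = gr_class F a y <-> fgt F a (x - y).
Proof.
move=> /gr_classW[r -> rE] /gr_classW[s -> sE].
rewrite gr_piP rE sE; split=> [/(_ a)|xy b]; first by rewrite !mcoeffUU.
rewrite !mcoeffU; have [<-|_] := eqVneq a b; rewrite ?mulr1n //.
by rewrite !mulr0n subrr; exact: fgt0.
Qed.

Lemma gr_class0 a : gr_class F a 0 = 0.
Proof.
have [r -> rE] := gr_classW (fge0 F a).
by rewrite -(rmorph0 (@gr_pi Phi A F)); apply: gr_piE; rewrite rE monalgU0.
Qed.

Lemma gr_class_eq0 a x : fge F a x -> gr_class F a x = 0 <-> fgt F a x.
Proof. by move=> ax; rewrite -(gr_class0 a) gr_classP ?subr0 //; exact: fge0. Qed.

Lemma gr_classD a x y : fge F a x -> fge F a y ->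
  gr_class F a (x + y) = gr_class F a x + gr_class F a y.
Proof.
move=> ax ay; have [t -> tE] := gr_classW (fgeD ax ay).
have [r -> rE] := gr_classW ax; have [s -> sE] := gr_classW ay.
by rewrite -rmorphD; apply: gr_piE; rewrite tE rmorphD /= rE sE monalgUD.
Qed.

Lemma gr_class_sum a (T : Type) (l : seq T) (P : pred T) (G : T -> A) :
  (forall t, P t -> fge F a (G t)) ->
  gr_class F a (\sum_(t <- l | P t) G t) = \sum_(t <- l | P t) gr_class F a (G t).
Proof.
move=> FG; suff [] : fge F a (\sum_(t <- l | P t) G t) /\
  gr_class F a (\sum_(t <- l | P t) G t) = \sum_(t <- l | P t) gr_class F a (G t) by [].
elim/big_rec2: _ => [|t y x Pt [ax xy]]; first by split; [exact: fge0|exact: gr_class0].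
by split; [apply: fgeD => //; exact: FG|rewrite gr_classD ?xy //; exact: FG].
Qed.

Lemma gr_class1 : gr_class F mone 1 = 1.
Proof.
have [r -> rE] := gr_classW (fge1 F).
by rewrite -(rmorph1 (@gr_pi Phi A F)); apply: gr_piE; rewrite rE rmorph1.
Qed.

Lemma gr_classM a b x y : fge F a x -> fge F b y ->
  gr_class F (mmul a b) (x * y) = gr_class F a x * gr_class F b y.
Proof.
move=> ax ay; have [t -> tE] := gr_classW (fgeM ax ay).
have [r -> rE] := gr_classW ax; have [s -> sE] := gr_classW ay.
by rewrite -rmorphM; apply: gr_piE; rewrite tE rmorphM /= rE sE malgM_def fgmulUU.
Qed.

Lemma gr_classX a x n : fge F a x ->
  exists2 b : nneg Phi, (b : Phi) = (a : Phi) *+ n &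
    fge F b (x ^+ n) /\ gr_class F b (x ^+ n) = gr_class F a x ^+ n.
Proof.
move=> ax; elim: n => [|n [b bE [bx bxE]]].
  by exists mone => //; split; [exact: fge1|exact: gr_class1].
exists (mmul a b); first by rewrite nneg_mulE bE mulrS.
by split; rewrite exprS; [exact: fgeM|rewrite gr_classM // bxE exprS].
Qed.

(** Several terms may share a degree, so they are added within each degree first; the coefficients
    of a Rees element are then compared with [fgt] independently. *)
Lemma gr_class_sum_eq (T : Type) (l : seq T) (w : T -> nneg Phi) (G : T -> A) :
  (forall t, fge F (w t) (G t)) ->
  \sum_(t <- l) gr_class F (w t) (G t) = 0 <->
  forall a, fgt F a (\sum_(t <- l | w t == a) G t).
Proof.
move=> FG; under eq_bigr do rewrite gr_class_pi.
rewrite -raddf_sum -(raddf0 (@gr_pi Phi A F)) gr_piP.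
have sumE a : (val (\sum_(t <- l) reesU (w t) (G t)))@_a =
    \sum_(t <- l | w t == a) G t.
  rewrite !raddf_sum [RHS]big_mkcond /=; apply: eq_bigr => t _.
  by rewrite (val_reesU (FG t)) mcoeffU; case: ifP; rewrite ?mulr1n ?mulr0n.
by split=> h a; move: (h a); rewrite sumE mcoeff0 subr0.
Qed.

Lemma gr_sum_classes (y : gr F) : exists l : seq (nneg Phi * A),
  (forall t, t \in l -> fge F t.1 t.2) /\ y = \sum_(t <- l) gr_class F t.1 t.2.
Proof.
pose r := repr y; have yE : y = gr_pi r by rewrite /gr_pi reprK.
have rP : forall a, fge F a (val r)@_a by case: (r) => z /= /asboolP.
exists [seq (a, (val r)@_a) | a <- msupp (val r)]; split.
  by move=> _ /mapP[a _ ->] /=.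
rewrite big_map yE; under eq_bigr do rewrite gr_class_pi.
rewrite -raddf_sum; congr gr_pi; apply: val_inj.
rewrite raddf_sum /= [LHS]monalgE; apply: eq_bigr => a _.
by rewrite val_reesU.
Qed.

End GradedRingTheory.

Section GradedMapTheory.
Variables (Phi : orderedGroupType) (A B : comNzRingType).
Variables (F : filtration Phi A) (G : filtration Phi B) (f : {additive A -> B}).
Hypothesis ff : filtered_map F G f.

(** [gr_map] applies [f] to a chosen Rees representative. Since [f] respects [fgt], any other
    representative gives the same class, so the image can be read off any expression as a sum of
    classes. *)
Lemma gr_map_sum (T : Type) (l : seq T) (w : T -> nneg Phi) (x : T -> A) :
  (forall t, fge F (w t) (x t)) ->
  gr_map F G f (\sum_(t <- l) gr_class F (w t) (x t)) =
  \sum_(t <- l) gr_class G (w t) (f (x t)).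
Proof.
move=> xF; rewrite /gr_map; set y := \sum_(t <- l) _; set r := repr y.
have yE : gr_pi r = \sum_(t <- l) gr_pi (reesU F (w t) (x t)).
  by rewrite /gr_pi /r reprK.
have rF a : fge F a (val r)@_a by case: (r) => z /= /asboolP.
rewrite (eq_bigr (fun t => gr_pi (reesU G (w t) (f (x t))))) // -raddf_sum.
move: yE; rewrite -raddf_sum => /gr_piP yE; apply/gr_piP => a.
have -> : (val (insubd (0 : rees G) [malg b in msupp (val r) => f (val r)@_b]))@_a =
    f (val r)@_a.
  rewrite insubdK; last first.
    apply/asboolP => b; rewrite mcoeffE; case: ifP => _; [exact/ff.1|exact: fge0].
  by rewrite mcoeffE; case: msuppP; rewrite ?raddf0.
have := ff.2 _ _ (yE a); congr fgt; rewrite raddfB; congr (_ - _).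
rewrite !raddf_sum /=; apply: eq_bigr => t _.
have fxG : fge G (w t) (f (x t)) by exact/ff.1.
rewrite (val_reesU (xF t)) (val_reesU fxG) !mcoeffU.
by case: eqP; rewrite ?mulr1n ?mulr0n ?raddf0.
Qed.

End GradedMapTheory.

(** * Evaluation of polynomials in a ring and in its associated graded ring *)

Section EvaluationTheory.
Variables (I : choiceType) (A : comNzRingType) (x : I -> A).
Implicit Types (e d : {cmonom I}).

Lemma mon_evalE (D : {fset I}) e : (finsupp e `<=` D)%fset ->
  mon_eval x e = \prod_(i <- D) x i ^+ e i.
Proof.
move=> eD; rewrite /mon_eval (big_fset_incl _ eD) // => i _.
by rewrite -cmE_eq0 => /eqP ->.
Qed.

Lemma mon_eval1 : mon_eval x mone = 1.
Proof. by rewrite /mon_eval mdom1 big_seq_fset0. Qed.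

Lemma mon_evalM e d : mon_eval x (mmul e d) = mon_eval x e * mon_eval x d.
Proof.
rewrite {1}/mon_eval mdomD (mon_evalE (fsubsetUl _ (finsupp d))).
rewrite (mon_evalE (fsubsetUr (finsupp e) _)) -big_split /=.
by apply: eq_bigr => i _; rewrite cmM exprD.
Qed.

Lemma mon_evalU i : mon_eval x (ucm i) = x i.
Proof. by rewrite /mon_eval mdomU big_seq_fset1 cmUU expr1. Qed.

Fact mon_eval_mmorphism : mmorphism (mon_eval x).
Proof. by split; [exact: mon_evalM|exact: mon_eval1]. Qed.

HB.instance Definition _ :=
  isMultiplicative.Build {cmonom I} A (mon_eval x) mon_eval_mmorphism.

Variables (k : fieldType) (s : {rmorphism k -> A}).

HB.instance Definition _ := GRing.RMorphism.copy (poly_eval s x) (mmap s (mon_eval x)).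

Lemma poly_evalU c e : poly_eval s x << c *g e >> = s c * mon_eval x e.
Proof. exact: mmapU. Qed.

Lemma poly_evalU1 e : poly_eval s x << e >> = mon_eval x e.
Proof. by have := poly_evalU 1 e; rewrite rmorph1 mul1r. Qed.

Lemma mcoeff_mbinomial e d (c : k) e' :
  (mbinomial e d c)@_e' = (e == e')%:R - c *+ (d == e').
Proof.
transitivity ((<< e >> : {malg k[{cmonom I}]})@_e' - << c *g d >>@_e').
  exact: mcoeffB.
by congr (_ - _); [exact: mcoeffU1|exact: mcoeffU].
Qed.

Lemma poly_eval_mbinomial e d c :
  poly_eval s x (mbinomial e d c) = mon_eval x e - s c * mon_eval x d.
Proof.
transitivity (poly_eval s x << e >> - poly_eval s x << c *g d >>).
  exact: rmorphB.
by congr (_ - _); [exact: poly_evalU1|exact: poly_evalU].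
Qed.

End EvaluationTheory.

Section GradedEvaluation.
Variables (Phi : orderedGroupType) (A : comNzRingType) (F : filtration Phi A).
Variables (k : fieldType) (s : {rmorphism k -> A}).
Hypothesis sF : forall c, fge F mone (s c).
Variables (I : choiceType).
Implicit Types (e d : {cmonom I}) (p : {malg k[{cmonom I}]}).

Lemma gr_scalar_rmorphism : exists g : {rmorphism k -> gr F},
  gr_scalar F s = g.
Proof.
have gD : zmod_morphism (gr_scalar F s).
  move=> c d; have := gr_classD (sF (c - d)) (sF d).
  by rewrite -rmorphD subrK => cd; rewrite /gr_scalar cd addrK.
have gM : monoid_morphism (gr_scalar F s).
  split; first by rewrite /gr_scalar rmorph1; exact: gr_class1.
  by move=> c d; rewrite /gr_scalar rmorphM -(gr_classM (sF c) (sF d)) mulm1.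
pose gDB := GRing.isZmodMorphism.Build _ _ (gr_scalar F s) gD.
pose gMB := GRing.isMonoidMorphism.Build _ _ (gr_scalar F s) gM.
pose g : {rmorphism k -> gr F} := HB.pack (gr_scalar F s) gDB gMB.
by exists g.
Qed.

Lemma gr_poly_eval_rmorphism (X : I -> gr F) :
  exists g : {rmorphism {malg k[{cmonom I}]} -> gr F},
    poly_eval (gr_scalar F s) X = g.
Proof.
have [g ->] := gr_scalar_rmorphism.
by exists (poly_eval g X : {rmorphism _ -> _}).
Qed.

Variables (gamma : I -> nneg Phi) (x : I -> A).
Hypothesis xF : forall i, fge F (gamma i) (x i).

Lemma weight_ge0 e : 0 <= weight gamma e.
Proof.
rewrite /weight; elim/big_ind: _ => // [a b a0 b0|i _].
  by rewrite -[0]addr0; exact: og_leD.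
elim: (e i) => [|n IH]; first by rewrite mulr0n.
by rewrite mulrS -[0]addr0; apply: og_leD => //; exact: nneg_ge0.
Qed.

Definition nnweight e : nneg Phi := NNeg (weight_ge0 e).

Lemma gr_mon_eval e : fge F (nnweight e) (mon_eval x e) /\
  mon_eval (fun i => gr_class F (gamma i) (x i)) e =
    gr_class F (nnweight e) (mon_eval x e).
Proof.
suff [b be [bF bE]] : exists2 b : nneg Phi, (b : Phi) = weight gamma e &
    fge F b (mon_eval x e) /\
    gr_class F b (mon_eval x e) = mon_eval (fun i => gr_class F (gamma i) (x i)) e.
  by have -> : nnweight e = b by apply: val_inj; rewrite /= be.
rewrite /weight /mon_eval.
elim: (enum_fset (finsupp e)) => [|i l [b bE [bF bc]]].
  by exists mone; rewrite !big_nil //; split; [exact: fge1|exact: gr_class1].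
have [c cE [cF cc]] := gr_classX (e i) (xF i).
exists (mmul c b); first by rewrite nneg_mulE cE bE big_cons.
by rewrite !big_cons; split; [exact: fgeM|rewrite gr_classM // cc bc].
Qed.

Lemma fge_mon_eval e : fge F (nnweight e) (mon_eval x e).
Proof. by case: (gr_mon_eval e). Qed.

Lemma fge_term c e : fge F (nnweight e) (s c * mon_eval x e).
Proof.
by rewrite -[nnweight e]mul1m; apply: fgeM => //; exact: fge_mon_eval.
Qed.

Lemma gr_poly_evalE p :
  poly_eval (gr_scalar F s) (fun i => gr_class F (gamma i) (x i)) p =
  \sum_(e <- msupp p) gr_class F (nnweight e) (s p@_e * mon_eval x e).
Proof.
apply: eq_bigr => e _; have [eF ->] := gr_mon_eval e.
by rewrite /gr_scalar -(gr_classM (sF _) eF) mul1m.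
Qed.

Lemma gr_poly_eval_eq0 p :
  poly_eval (gr_scalar F s) (fun i => gr_class F (gamma i) (x i)) p = 0 <->
  forall a, fgt F a (\sum_(e <- msupp p | nnweight e == a) s p@_e * mon_eval x e).
Proof. by rewrite gr_poly_evalE; apply: gr_class_sum_eq => e; exact: fge_term. Qed.

Lemma gr_poly_eval_mbinomial_eq0 e d c : weight gamma e = weight gamma d ->
  fgt F (nnweight e) (mon_eval x e - s c * mon_eval x d) ->
  poly_eval (gr_scalar F s) (fun i => gr_class F (gamma i) (x i)) (mbinomial e d c) = 0.
Proof.
move=> wed ed; have [g gE] := gr_scalar_rmorphism.
rewrite gE poly_eval_mbinomial -gE.
have [eF ->] := gr_mon_eval e; have [dF ->] := gr_mon_eval d.
rewrite /gr_scalar -(gr_classM (sF c) dF) mul1m.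
have wde : nnweight d = nnweight e by apply: val_inj; rewrite /= wed.
have := fge_term c d; rewrite wde => cdF.
by apply/eqP; rewrite subr_eq0; apply/eqP/(gr_classP eF cdF).
Qed.

Lemma gr_poly_eval_homogeneous (a : nneg Phi) p :
  (forall e, e \in msupp p -> weight gamma e = a) ->
  fge F a (poly_eval s x p) /\
  poly_eval (gr_scalar F s) (fun i => gr_class F (gamma i) (x i)) p =
    gr_class F a (poly_eval s x p).
Proof.
move=> pa; have we e : e \in msupp p -> nnweight e = a.
  by move=> /pa ea; apply: val_inj; rewrite /= ea.
have teF e : e \in msupp p -> fge F a (s p@_e * mon_eval x e).
  by move=> /we <-; exact: fge_term.
have pE : poly_eval s x p = \sum_(e <- msupp p | e \in msupp p) s p@_e * mon_eval x e.
  by rewrite /poly_eval mmapE [LHS]big_seq.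
rewrite gr_poly_evalE pE [X in X = _]big_seq; split; first exact: fge_sum.
by rewrite (gr_class_sum _ teF); apply: eq_bigr => e /we ->.
Qed.

Lemma generated_weight (a : nneg Phi) (y : A) :
  generates (gr_scalar F s) (fun i => gr_class F (gamma i) (x i)) setT ->
  fge F a y -> ~ fgt F a y -> exists e, weight gamma e = a.
Proof.
move=> gen ay nay; apply: contrapT => ne; apply: nay.
have [p _ yp] := gen (gr_class F a y).
(* [None] stands for [y] in degree [a] and [Some e] for the terms of [-p]. The whole sum is zero,
   and if no monomial has weight [a], only [y] remains in that degree. *)
pose w (t : option {cmonom I}) := oapp nnweight a t.
pose G (t : option {cmonom I}) := oapp (fun e => s (- p)@_e * mon_eval x e) y t.
have GF t : fge F (w t) (G t) by case: t => [e|//]; exact: fge_term.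
have /(gr_class_sum_eq _ GF) :
    \sum_(t <- None :: [seq Some e | e <- msupp (- p)]) gr_class F (w t) (G t) = 0.
  rewrite big_cons big_map /= yp -gr_poly_evalE.
  by have [g ->] := gr_poly_eval_rmorphism (fun i => gr_class F (gamma i) (x i));
    rewrite rmorphN subrr.
move=> /(_ a); rewrite big_cons /= eqxx big_map big_pred0 ?addr0 // => e.
by apply/eqP => /(congr1 val) /= ea; apply: ne; exists e.
Qed.

End GradedEvaluation.

Section GradedMapEvaluation.
Variables (Phi : orderedGroupType) (A B : comNzRingType).
Variables (F : filtration Phi A) (G : filtration Phi B) (f : {rmorphism A -> B}).
Variables (k : fieldType) (s : {rmorphism k -> A}) (t : {rmorphism k -> B}).
Variables (I : choiceType) (gamma : I -> nneg Phi) (x : I -> A).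
Hypothesis ff : filtered_map F G f.
Hypothesis sF : forall c, fge F mone (s c).
Hypothesis xF : forall i, fge F (gamma i) (x i).
Hypothesis fs : forall c, f (s c) = t c.

Lemma gr_map_poly_eval p :
  gr_map F G f (poly_eval (gr_scalar F s) (fun i => gr_class F (gamma i) (x i)) p) =
  poly_eval (gr_scalar G t) (fun i => gr_class G (gamma i) (f (x i))) p.
Proof.
have tG c : fge G mone (t c) by rewrite -fs; exact/ff.1.
have fxG i : fge G (gamma i) (f (x i)) by exact/ff.1.
rewrite (gr_poly_evalE sF xF) (gr_poly_evalE tG fxG).
rewrite (gr_map_sum ff) => [|e]; last exact: fge_term.
apply: eq_bigr => e _; congr gr_class.
transitivity (f (s p@_e) * f (mon_eval x e)); first exact: rmorphM.
rewrite fs; congr (_ * _).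
by rewrite rmorph_prod; apply: eq_bigr => i _; rewrite rmorphXn.
Qed.

End GradedMapEvaluation.

Section SeriesOfPolynomials.
Variables (k : fieldType) (I : choiceType).
Implicit Types (e d : {cmonom I}) (p q : {malg k[{cmonom I}]}).

Definition series_of p : formal_series k I := fun e => p@_e.

Fact series_of_zmod_morphism : zmod_morphism series_of.
Proof. by move=> p q; apply/funext => e; exact: mcoeffB. Qed.

Fact series_of_monoid_morphism : monoid_morphism series_of.
Proof.
split=> [|p q]; first by apply/funext => e; exact: mcoeff1.
by apply/funext => e; apply/esym/smulE.
Qed.

HB.instance Definition _ := GRing.isZmodMorphism.Build {malg k[{cmonom I}]}
  (formal_series k I) series_of series_of_zmod_morphism.
HB.instance Definition _ := GRing.isMonoidMorphism.Build {malg k[{cmonom I}]}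
  (formal_series k I) series_of series_of_monoid_morphism.

Lemma series_ofU c e : series_of << c *g e >> = c *: smon k e.
Proof.
apply/funext => d; rewrite /series_of mcoeffU -mulr_natr eq_sym.
by [].
Qed.

Lemma series_ofU1 e : series_of << e >> = smon k e.
Proof. by rewrite series_ofU scale1r. Qed.

Lemma mon_eval_svar e : mon_eval (@svar k I) e = smon k e.
Proof.
have [n] := ubnP (mdeg e); elim: n e => // n IH e en.
have [->|e1] := eqVneq e mone; first by rewrite mon_eval1.
have [i ie] : exists i, e i != 0%N.
  apply: contrapT => ne; case/eqP: e1; apply/eqP/cmP => i; rewrite cm1.
  by apply: contrapT => /eqP ei; apply: ne; exists i.
have eE : mmul (ucm i) (divcm e (ucm i)) = e.
  apply/eqP/cmP => j; rewrite cmM divcmE subnKC // cmU.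
  by have [<-|] := eqVneq i j; rewrite ?lt0n.
rewrite -eE mon_evalM mon_evalU IH; last first.
  by move: en; rewrite -{1}eE mdegM mdegU add1n ltnS.
rewrite /svar -!series_ofU1 -rmorphM; congr series_of.
by rewrite malgM_def fgmulUU mulr1.
Qed.

Lemma poly_eval_svar p : poly_eval (GRing.in_alg (formal_series k I)) (@svar k I) p = series_of p.
Proof.
rewrite [in RHS](monalgE p) rmorph_sum; apply: eq_bigr => e _.
by rewrite mon_eval_svar [RHS]series_ofU -mulr_algl.
Qed.

End SeriesOfPolynomials.

(** * Choice of the representatives *)

Section MinimalGenerators.
Variables (I : choiceType) (k : fieldType) (A : comNzRingType).
Variables (s : {rmorphism k -> A}) (x : I -> A).

Definition avoids (i : I) (p : {malg k[{cmonom I}]}) : Prop :=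
  forall e : {cmonom I}, e i != 0%N -> p@_e = 0.

Lemma avoidsD i p q : avoids i p -> avoids i q -> avoids i (p + q).
Proof. by move=> pi qi e ei; rewrite mcoeffD pi // qi // addr0. Qed.

Lemma avoidsM i p q : avoids i p -> avoids i q -> avoids i (p * q).
Proof.
move=> pi qi e ei; rewrite mcoeffMl big1 // => d _; rewrite big1 // => d' _.
case: eqP => // dd'; rewrite mulr1n; move: ei; rewrite -dd' cmM addn_eq0 negb_and.
by case/orP => ei; [rewrite (pi _ ei) mul0r|rewrite (qi _ ei) mulr0].
Qed.

Lemma avoidsC i c : avoids i c%:MP.
Proof. by move=> e; rewrite mcoeffC; have [->|_ _] := eqVneq e mone; rewrite ?cm1. Qed.

Lemma avoids0 i : avoids i 0.
Proof. by move=> e _; exact: mcoeff0. Qed.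

Lemma avoids1 i : avoids i 1.
Proof. by rewrite -mpolyC1E; exact: avoidsC. Qed.

(** Otherwise substituting [q] for [U_i] in polynomials shows that the generators other than [x i]
    still generate. *)
Lemma minimal_generators_irredundant i q :
  minimal_generators s x -> avoids i q -> x i <> poly_eval s x q.
Proof.
move=> [gen min] qi xiq.
suff /min JT : generates s x [set j | j <> i].
  by have : setT i by []; rewrite -JT.
move=> y; have [p _ ->] := gen y.
pose v j : {malg k[{cmonom I}]} := if j == i then q else << ucm j >>.
exists (poly_eval malgC v p); last first.
  transitivity (\sum_(e <- msupp p) poly_eval s x ((p@_e)%:MP * mon_eval v e)).
    2: by rewrite -raddf_sum.
  apply: eq_bigr => e _; rewrite rmorphM /= poly_evalU mon_eval1 mulr1; congr (_ * _).
  rewrite rmorph_prod; apply: eq_bigr => j _; rewrite rmorphXn /=; congr (_ ^+ _).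
  rewrite /v; case: eqP => [->//|_].
  by rewrite poly_evalU rmorph1 mul1r mon_evalU.
suff pi : avoids i (poly_eval malgC v p).
  move=> e ep j /= je ji; move: ep; rewrite -mcoeff_neq0 pi ?eqxx //.
  by rewrite cmE_neq0 -ji.
have vi j : avoids i (v j).
  rewrite /v; case: eqP => [//|/eqP ji] e; rewrite mcoeffU1.
  by have [<-|//] := eqVneq (ucm j) e; rewrite cmU (negbTE ji).
rewrite /poly_eval mmapE; elim/big_rec: _ => [|e r _ ri]; first exact: avoids0.
apply: avoidsD ri; apply: avoidsM; first exact: avoidsC.
rewrite /mon_eval; elim/big_rec: _ => [|j r' _ ri]; first exact: avoids1.
apply: avoidsM ri; elim: (e j) => [|n IH]; first exact: avoids1.
by rewrite exprS; apply: avoidsM.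
Qed.

End MinimalGenerators.

Section Representatives.
Variables (R : idomainType) (m : set R).
Variables (k : fieldType) (iota : {rmorphism k -> R}).
Variables (Phi : orderedGroupType) (nu : valuation {fraction R} Phi).
Variables (I : choiceType) (gamma : I -> nneg Phi).
Hypothesis noeR : noetherian R.
Hypothesis kR : field_of_representatives m iota.
Hypothesis domR : dominates nu m.
Hypothesis ratR : rational nu.

Local Notation F := (val_filtration nu).

Lemma iota_fge (c : k) : fge F mone (iota c).
Proof. exact: (rge0 domR). Qed.

Variable xibar : I -> gr F.
Hypothesis xibar_minimal : minimal_generators (gr_scalar F iota) xibar.

Lemma xibar_irredundant i q : avoids i q ->
  xibar i <> poly_eval (gr_scalar F iota) xibar q.
Proof.
move: xibar_minimal; have [g ->] := gr_scalar_rmorphism iota_fge.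
exact: minimal_generators_irredundant.
Qed.

Lemma xibar_monomial i j c : i <> j -> xibar i <> gr_scalar F iota c * xibar j.
Proof.
move=> ij xij; apply: (@xibar_irredundant i << c *g ucm j >>).
  move=> e; rewrite mcoeffU; have [<-|_ _] := eqVneq (ucm j) e; last by rewrite mulr0n.
  by rewrite cmU; have [ji|//] := eqVneq j i; case: ij.
rewrite xij; have [g ->] := gr_scalar_rmorphism iota_fge.
by rewrite poly_evalU mon_evalU.
Qed.

Variable x0 : I -> R.
Hypothesis x0_ge : forall i, fge F (gamma i) (x0 i).
Hypothesis x0_class : forall i, xibar i = gr_class F (gamma i) (x0 i).

Lemma representative_rgtN i : ~ rgt nu (gamma i) (x0 i).
Proof.
move=> x0i; apply: (@xibar_irredundant i 0); first exact: avoids0.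
have [g ->] := gr_poly_eval_rmorphism iota_fge xibar.
by rewrite rmorph0 x0_class; apply/(gr_class_eq0 (x0_ge i)).
Qed.

(** A generator of degree zero would be the class of a scalar, hence the value of a constant
    polynomial. *)
Lemma gamma_gt0 i : 0 < (gamma i : Phi).
Proof.
apply: contrapT => /og_ltNle g0.
have gi : gamma i = mone.
  by apply: val_inj; apply/le_anti; rewrite g0 nneg_ge0.
have [c /(mrgt domR) xc] := iota_mod_m kR (x0 i).
apply: (@xibar_irredundant i c%:MP); first exact: avoidsC.
have -> : poly_eval (gr_scalar F iota) xibar c%:MP = gr_scalar F iota c.
  have [g ->] := gr_scalar_rmorphism iota_fge.
  by rewrite poly_evalU mon_eval1 mulr1.
rewrite x0_class gi; apply/gr_classP => //; last exact: iota_fge.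
by have := x0_ge i; rewrite gi.
Qed.

(** Components of the graded ring are one-dimensional, so two generators of one degree would be
    proportional and one of them redundant. *)
Lemma gamma_inj : injective gamma.
Proof.
move=> i j gij; apply: contrapT => /eqP ij.
have x0j : fge F (gamma i) (x0 j) by rewrite gij.
have nx0j : ~ rgt nu (gamma i) (x0 j) by rewrite gij; exact: representative_rgtN.
have [c xc] := rgt_span1 domR kR ratR x0j nx0j (x0_ge i).
apply: (@xibar_monomial i j c); first exact/eqP.
rewrite !x0_class /gr_scalar -(gr_classM (iota_fge c) (x0_ge j)) mul1m -gij.
apply/gr_classP => //.
by have := fgeM (iota_fge c) x0j; rewrite mul1m.
Qed.

Definition reached n (a : Phi) : Prop :=
  exists y, [/\ ideal_exp m n y, y != 0 & rval nu y = a].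

Lemma deep_representative i : exists x,
  [/\ fge F (gamma i) x, gr_class F (gamma i) x = xibar i
    & forall n, reached n (gamma i) -> ideal_exp m n x].
Proof.
have nx0 := @representative_rgtN i.
(* An element of [m^n] of value [gamma i] becomes a representative of [xibar i] after multiplication
   by a scalar. *)
have multiple n : reached n (gamma i) ->
    exists2 x, ideal_exp m n x & rge nu (gamma i) x /\ rgt nu (gamma i) (x0 i - x).
  move=> [y [my y0 yE]].
  have yi : rge nu (gamma i) y by rewrite -yE; exact: rval_rge.
  have nyi : ~ rgt nu (gamma i) y by rewrite -yE; exact: rval_rgtN.
  have [c xc] := rgt_span1 domR kR ratR yi nyi (x0_ge i).
  exists (iota c * y); first by apply: ideal_mull => //; exact: ideal_exp_ideal.
  by split=> //; apply: ideal_mull => //; exact: (rge_ideal domR).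
(* If every power of [m] reached the value, [x0 i] would be an [m]-adic limit of elements of
   [rgt (gamma i)], hence in it by [rgt_closed]. *)
have [N NP nN] : exists2 N, reached N (gamma i) & ~ reached N.+1 (gamma i).
  apply: contrapT => noN; apply: (nx0).
  apply: (rgt_closed noeR domR) => n.
  have [x mx [_ xi]] : exists2 x, ideal_exp m n x &
      rge nu (gamma i) x /\ rgt nu (gamma i) (x0 i - x).
    apply: multiple; elim: n => [|n IH].
      exists (x0 i); split=> //; first exact: rgtN_neq0 nx0.
      exact: rval_eq (x0_ge i) nx0.
    by apply: contrapT => nS; apply: noN; exists n.
  by exists (x0 i - x) => //; rewrite opprB addrC subrK.
have [x mx [xi x0x]] := multiple _ NP; exists x; split; first exact: xi.
  rewrite x0_class; apply/(gr_classP (xi : fge F _ _) (x0_ge i)).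
  by rewrite -opprB; apply: idealN => //; exact: (rgt_ideal domR).
move=> n [y [my y0 yE]]; apply: (@ideal_exp_le _ m n N) mx.
rewrite leqNgt; apply/negP => Nn; apply: nN; exists y; split=> //.
exact: ideal_exp_le Nn _ my.
Qed.

End Representatives.

(** * Evaluation of formal series and its kernel *)

(** Extending the earlier values by [v0] gives [step] a total function, free of proofs of
    [lt a b]. *)
Lemma wf_rec_exists (T V : Type) (lt : T -> T -> Prop) (v0 : V) (step : T -> (T -> V) -> V) :
  well_founded lt ->
  exists c : T -> V, forall b, c b = step b (fun a => if pselect (lt a b) then c a else v0).
Proof.
move=> wf.
pose st b (c : forall a, lt a b -> V) :=
  step b (fun a => if pselect (lt a b) is left ab then c a ab else v0).
exists (Fix wf (fun _ => V) st) => b; rewrite Fix_eq.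
  by rewrite {1}/st; congr step; apply/funext => a; case: pselect.
move=> b' c c' cc'; rewrite /st; congr step; apply/funext => a.
by case: pselect.
Qed.

Section Evaluation.
Variables (R : idomainType) (m : set R).
Variables (k : fieldType) (iota : {rmorphism k -> R}).
Variables (Phi : orderedGroupType) (nu : valuation {fraction R} Phi).
Variables (I : choiceType) (gamma : I -> nneg Phi) (xi : I -> R).
Hypothesis noeR : noetherian R.
Hypothesis complR : adic_complete m.
Hypothesis kR : field_of_representatives m iota.
Hypothesis domR : dominates nu m.
Hypothesis ratR : rational nu.
Hypothesis gammaI : injective gamma.
Hypothesis gamma_pos : forall i, 0 < (gamma i : Phi).
Hypothesis xi_ge : forall i, rge nu (gamma i) (xi i).
Hypothesis xi_gtN : forall i, ~ rgt nu (gamma i) (xi i).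
Hypothesis xi_deep : forall i n, reached m nu n (gamma i) -> ideal_exp m n (xi i).

Implicit Types (e d : {cmonom I}) (p q : {malg k[{cmonom I}]}) (f g h : formal_series k I).

Local Notation weight := (weight gamma).
Local Notation mon := (mon_eval xi).

(** If [gamma i] is reached in [m^n], then [xi i] lies there by its choice; finitely many values are
    not reached, and [gamma] is injective. *)
Lemma xi_almost_all n : exists D : {fset I}, forall i, i \notin D -> ideal_exp m n (xi i).
Proof.
have [l lP] := finite_values_mod noeR domR kR n.
pose S := [set i | (gamma i : Phi) \in l].
have finS : finite_set S.
  have inj : {in S &, injective (fun i => gamma i : Phi)}.
    by move=> i j _ _ /val_inj/gammaI.
  apply: (@sub_finite_set _ _ ((fun i => gamma i : Phi) @^-1` [set` l])) => //.
  by apply: finite_preimage; [move=> i j _ _ /val_inj/gammaI|exact: finite_seq].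
exists (fset_set S) => i; rewrite in_fset_set // => /negP iS.
apply: xi_deep.
have xii : rval nu (xi i) = gamma i by apply: rval_eq.
have [|] := lP (xi i) (rgtN_neq0 (xi_gtN (i := i))); last by rewrite xii.
by rewrite xii => il; case: iS; exact/mem_set.
Qed.

Lemma mon_ideal_exp e : ideal_exp m (mdeg e) (mon e).
Proof.
rewrite mdegE /mon_eval; elim: (enum_fset (finsupp e)) => [|i l IH].
  by rewrite !big_nil.
rewrite !big_cons; apply: ideal_exp_mul => //.
elim: (e i) => [//|n {}IH]; rewrite exprS; apply: ideal_expS => //.
by apply/(mrgt domR); apply: rge_rgt (gamma_pos i) _.
Qed.

Lemma finite_mon n : finite_set [set e | ~ ideal_exp m n (mon e)].
Proof.
have [D DP] := xi_almost_all n.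
(* A monomial outside [m^n] involves only indices in [D], and its degree is below [n] since every
   [xi i] is in [m]. Hence it divides [e0], which has finitely many divisors. *)
pose e0 : {cmonom I} := [cmonom n | i in D]%M.
apply: (@sub_finite_set _ _ (fst @` [set p | mmul p.1 p.2 = e0])); last first.
  exact/finite_image/finite_factorizations.
move=> e /= ne; exists (e, divcm e0 e) => //=.
have eD i : i \in finsupp e -> i \in D.
  move=> ie; apply: contrapT => /negP /DP mi; apply: ne.
  rewrite /mon_eval (big_fsetD1 i) //=.
  apply: ideal_mulr; first exact: ideal_exp_ideal.
  move: ie; rewrite -cmE_neq0; case: (e i) => // j _; rewrite exprS.
  by apply: ideal_mulr => //; exact: ideal_exp_ideal.
have en i : (e i <= n)%N.
  rewrite leqNgt; apply/negP => ni; apply: ne.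
  apply: (@ideal_exp_le _ m n (mdeg e)) (mon_ideal_exp e).
  apply: leq_trans (ltnW ni) _.
  have [ie|] := boolP (i \in finsupp e); last by rewrite -cmE_eq0 => /eqP ->.
  by rewrite mdegE (big_fsetD1 i) //= leq_addr.
apply/eqP/cmP => i; rewrite cmM divcmE.
have e0i : e0 i = if i \in D then n else 0%N by rewrite cmE fsfun_fun.
rewrite subnKC // e0i; case: ifPn => // /negP iD.
by rewrite leqn0 cmE_eq0; apply/negP => /eD.
Qed.

Definition large n : {fset {cmonom I}} := fset_set [set e | ~ ideal_exp m n (mon e)].

Lemma in_large n e : e \in large n <-> ~ ideal_exp m n (mon e).
Proof.
rewrite in_fset_set; last exact: finite_mon.
by split=> [/set_mem|?]; last exact/mem_set.
Qed.

Definition strunc_large n f : {malg k[{cmonom I}]} := [malg e in large n => f e].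

Lemma poly_eval_small n p : (forall e, e \in large n -> p@_e = 0) ->
  ideal_exp m n (poly_eval iota xi p).
Proof.
move=> pn; rewrite /poly_eval mmapE big_seq; apply: ideal_sum => [|e ep].
  exact: ideal_exp_ideal.
apply: ideal_mull; first exact: ideal_exp_ideal.
apply: contrapT => /in_large/pn pe.
by move: ep; rewrite -mcoeff_neq0 pe eqxx.
Qed.

(** Passing to a higher truncation adds only monomials outside [large n], whose values lie in
    [m^n]. *)
Lemma eval_limit f : exists l, forall n,
  ideal_exp m n (poly_eval iota xi (strunc_large n f) - l).
Proof.
apply: adic_limit => // n p np; rewrite -rmorphB; apply: poly_eval_small => e en.
rewrite mcoeffB !mcoeffE en; case: ifPn => [_|/negP []]; first by rewrite subrr.
by apply/in_large => /(ideal_exp_le np); exact/in_large.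
Qed.

Definition evals f : R := projT1 (cid (eval_limit f)).

Lemma evalsP f n : ideal_exp m n (poly_eval iota xi (strunc_large n f) - evals f).
Proof. by rewrite /evals; case: cid. Qed.

Lemma evals_eq f l :
  (forall n, ideal_exp m n (poly_eval iota xi (strunc_large n f) - l)) -> evals f = l.
Proof.
move=> fl; apply/eqP; rewrite -subr_eq0; apply/eqP.
case: complR => + _; apply=> n.
rewrite -(subrKA (poly_eval iota xi (strunc_large n f))).
apply: idealD => //; first exact: ideal_exp_ideal.
rewrite -opprB; apply: idealN; [exact: ideal_exp_ideal|exact: evalsP].
Qed.

Lemma evals_zmod_morphism : zmod_morphism evals.
Proof.
move=> f g; apply: evals_eq => n; pose t := strunc_large n.
have -> : poly_eval iota xi (t (f - g)) - (evals f - evals g) =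
    poly_eval iota xi (t (f - g) - t f + t g) +
    ((poly_eval iota xi (t f) - evals f) - (poly_eval iota xi (t g) - evals g)).
  by rewrite rmorphD rmorphB; ring.
apply: idealD; first exact: ideal_exp_ideal.
  apply: poly_eval_small => e en; rewrite mcoeffD mcoeffB !mcoeffE en.
  change (f e - g e - f e + g e = 0); ring.
by apply: idealB; [exact: ideal_exp_ideal|exact: evalsP|exact: evalsP].
Qed.

Lemma evals_poly f p : (forall e, f e = p@_e) -> evals f = poly_eval iota xi p.
Proof.
move=> fp; apply: evals_eq => n; rewrite -rmorphB; apply: poly_eval_small => e en.
by rewrite mcoeffB mcoeffE en fp subrr.
Qed.

Lemma evals_monoid_morphism : monoid_morphism evals.
Proof.
split=> [|f g].
  rewrite (@evals_poly 1 1) ?rmorph1 // => e.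
  by rewrite mcoeff1.
apply: evals_eq => n; pose t := strunc_large n.
have -> : poly_eval iota xi (t (f * g)) - evals f * evals g =
    poly_eval iota xi (t (f * g) - t f * t g) +
    (poly_eval iota xi (t f) * (poly_eval iota xi (t g) - evals g) +
     evals g * (poly_eval iota xi (t f) - evals f)).
  by rewrite rmorphB rmorphM; ring.
have iX := ideal_exp_ideal m n.
apply: idealD => //; last first.
  by apply: idealD => //; apply: ideal_mull => //; exact: evalsP.
apply: poly_eval_small => e en; rewrite mcoeffB mcoeffE en.
apply/eqP; rewrite subr_eq0; apply/eqP; apply: (@smulE k I f g) => d d' dd'.
(* [large n] is closed under divisors, so the truncations retain every coefficient that contributes
   to the one at [e]. *)
suff [dn d'n] : d \in large n /\ d' \in large n by rewrite !mcoeffE dn d'n.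
move/in_large: en; rewrite -dd' mon_evalM => nd; split; apply/in_large => md; apply: nd.
  exact: ideal_mulr.
exact: ideal_mull.
Qed.

(** The truncated sums lie in the ideal [rge a], which is [m]-adically closed. *)
Lemma evals_weight_ge a f : weight_ge gamma a f -> rge nu a (evals f).
Proof.
move=> fa; apply: (rge_closed noeR domR) => n.
exists (poly_eval iota xi (strunc_large n f)); last first.
  rewrite -opprB; apply: idealN; [exact: ideal_exp_ideal|exact: evalsP].
apply: ideal_sum => [|e _]; first exact: (rge_ideal domR).
rewrite mcoeffE; case: ifP => _; last first.
  by rewrite rmorph0 mul0r; exact: ideal0 (rge_ideal domR a).
have [->|fe] := eqVneq (f e) 0.
  by rewrite rmorph0 mul0r; exact: ideal0 (rge_ideal domR a).
apply: ideal_mull; first exact: (rge_ideal domR).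
have xiF i : fge (val_filtration nu) (gamma i) (xi i) by exact: xi_ge.
exact: rge_le (fa _ fe) (fge_mon_eval xiF e).
Qed.

Lemma evals_weight_gt a f : weight_gt gamma a f -> rgt nu a (evals f).
Proof.
move=> fa; apply: (rgt_closed noeR domR) => n.
exists (poly_eval iota xi (strunc_large n f)); last first.
  rewrite -opprB; apply: idealN; [exact: ideal_exp_ideal|exact: evalsP].
apply: ideal_sum => [|e _]; first exact: (rgt_ideal domR).
rewrite mcoeffE; case: ifP => _; last first.
  by rewrite rmorph0 mul0r; exact: ideal0 (rgt_ideal domR a).
have [->|fe] := eqVneq (f e) 0.
  by rewrite rmorph0 mul0r; exact: ideal0 (rgt_ideal domR a).
apply: ideal_mull; first exact: (rgt_ideal domR).
have xiF i : fge (val_filtration nu) (gamma i) (xi i) by exact: xi_ge.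
exact: rge_rgt (fa _ fe) (fge_mon_eval xiF e).
Qed.

Lemma rvalM x y : x != 0 -> y != 0 -> rval nu (x * y) = rval nu x + rval nu y.
Proof. by move=> x0 y0; rewrite /rval rmorphM Defs.valM ?tofrac_eq0. Qed.

Lemma rval_mon e : mon e != 0 /\ rval nu (mon e) = weight e.
Proof.
rewrite /mon_eval /Defs.weight; elim: (enum_fset (finsupp e)) => [|i l [l0 IH]].
  by rewrite !big_nil oner_neq0 /rval rmorph1 Defs.val1.
have x0 : xi i != 0 := rgtN_neq0 (xi_gtN (i := i)).
rewrite !big_cons mulf_neq0 ?expf_neq0 //; split=> //.
rewrite rvalM ?expf_neq0 // IH; congr (_ + _).
elim: (e i) => [|n {}IH]; first by rewrite expr0 mulr0n /rval rmorph1 Defs.val1.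
by rewrite exprS rvalM ?expf_neq0 // IH mulrS (rval_eq (xi_ge i)).
Qed.

Lemma mon_neq0 e : mon e != 0.
Proof. by case: (rval_mon e). Qed.

Lemma mon_rge e : rge nu (weight e) (mon e).
Proof. by have [_ <-] := rval_mon e; exact: rval_rge. Qed.

Lemma mon_rgtN e : ~ rgt nu (weight e) (mon e).
Proof. by have [e0 <-] := rval_mon e; exact: rval_rgtN. Qed.

(** Were there infinitely many, each [m^n] would contain one. A fixed [mon e0] of the same weight is
    a scalar multiple of it modulo [rgt a], so [rgt_closed] would put [mon e0] in [rgt a]. *)
Lemma finite_weight a : finite_set [set e | weight e = a].
Proof.
have [[e0 e0a]|na] := pselect (exists e, weight e = a); last first.
  by rewrite (_ : [set e | _] = set0) // -subset0 => e ea; apply: na; exists e.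
apply: contrapT => inf; apply: (@mon_rgtN e0); apply: (rgt_closed noeR domR) => n.
have [e ea me] : exists2 e, weight e = a & ideal_exp m n (mon e).
  apply: contrapT => ne; apply: inf; apply: sub_finite_set (finite_mon n) => e ea me.
  by apply: ne; exists e.
have [|||c ce] := @rgt_span1 _ _ _ _ domR _ _ kR ratR a (mon e) (mon e0).
- by rewrite -ea; exact: mon_rge.
- by rewrite -ea; exact: mon_rgtN.
- by rewrite -e0a; exact: mon_rge.
exists (mon e0 - iota c * mon e); first by rewrite e0a.
by rewrite opprB addrC subrK; apply: ideal_mull => //; exact: ideal_exp_ideal.
Qed.

Lemma evals_series_of p : evals (series_of p) = poly_eval iota xi p.
Proof. exact: evals_poly. Qed.

HB.instance Definition _ :=
  GRing.isZmodMorphism.Build (formal_series k I) R evals evals_zmod_morphism.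
HB.instance Definition _ :=
  GRing.isMonoidMorphism.Build (formal_series k I) R evals evals_monoid_morphism.

Lemma evals_smon e : evals (smon k e) = mon e.
Proof.
rewrite (@evals_poly _ << e >>) => [|d]; last by rewrite mcoeffU1 eq_sym.
by rewrite poly_evalU rmorph1 mul1r.
Qed.

Lemma evals_scale c f : evals (c *: f) = iota c * evals f.
Proof.
rewrite -mulr_algl rmorphM /=; congr (_ * _).
rewrite (@evals_poly _ c%:MP) => [|e].
  by rewrite poly_evalU mon_eval1 mulr1.
by rewrite mcoeffC -mulr_natr.
Qed.

Hypothesis xi_generates : generates (gr_scalar (val_filtration nu) iota)
  (fun i => gr_class (val_filtration nu) (gamma i) (xi i)) setT.

Lemma mon_attained x : x != 0 -> exists e, weight e = rval nu x.
Proof.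
move=> x0; pose a : nneg Phi := NNeg (rval_ge0 domR x0).
have xiF i : fge (val_filtration nu) (gamma i) (xi i) by exact: xi_ge.
apply: (generated_weight (iota_fge iota domR) xiF (a := a) xi_generates).
  exact: rval_rge.
exact: rval_rgtN.
Qed.

(* Successive approximation: subtracting from x the multiple of the chosen
   monomial of weight [rval x] raises the value, and the sums taken at limit
   stages converge. *)
Lemma evals_surj_gt a0 x : rgt nu a0 x -> exists2 f, weight_gt gamma a0 f & evals f = x.
Proof.
move=> x_gt.
have /choice[mo moP] a : exists e, (exists d, weight d = a) -> weight e = a.
  have [[d da]|nd] := pselect (exists d, weight d = a); first by exists d.
  by exists mone => /nd.
(* Coefficients are indexed by values. Only weights above [a0] occur, so that the lift can serve as
   the overweight part of a deformation. *)
pose ser (c : Phi -> k) : formal_series k I :=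
  fun e => if (a0 < weight e) && (e == mo (weight e)) then c (weight e) else 0.
pose good b c l := rgt nu b (x - evals (ser c) - iota l * mon (mo b)).
(* The coefficient at [b] cancels the part of value [b] of what the smaller values leave over;
   [xget] returns 0 when no scalar does so. *)
have [c cE] := wf_rec_exists 0 (fun b c => xget 0 [set l | good b c l])
  (value_lt_wf noeR domR).
pose cut (B : set Phi) a := if pselect (B a) then c a else 0.
have ser_gt c' : weight_gt gamma a0 (ser c').
  by move=> e; rewrite /ser; case: ifP => [/andP[]//|_]; rewrite eqxx.
have attained e : exists2 y, y != 0 & rval nu y = weight e.
  by exists (mon e); have [] := rval_mon e.
(* Coefficients beyond [a] change the sum only within [rgt a], so [B] may be larger than needed:
   below it is the set of values less than some [b > a], or [setT]. *)
have step a (B : set Phi) : a0 < a -> (exists d, weight d = a) -> B a ->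
    (forall e, weight e < a -> B (weight e)) ->
    rge nu a (x - evals (ser (cut (fun b => value_lt nu b a)))) ->
    rgt nu a (x - evals (ser (cut B))).
  move=> a0a aatt Ba Blt; set f := ser _ => xf.
  have moa := moP _ aatt.
  have gda : good a (cut (fun b => value_lt nu b a)) (c a).
    rewrite cE; apply: (@xgetPex _ 0 [set l | good a (cut (fun b => value_lt nu b a)) l]).
    apply: (rgt_span1 domR kR ratR) xf; rewrite -{1}moa; first exact: mon_rge.
    exact: mon_rgtN.
  have rest : weight_gt gamma a (ser (cut B) - f - c a *: smon k (mo a)).
    move=> e; apply: contra_neqT => /negP/og_ltNle; rewrite le_eqVlt => ea.
    change (ser (cut B) e - f e - c a * (e == mo a)%:R = 0).
    rewrite /f /ser; case/predU1P: ea => [ea|ea].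
      rewrite ea a0a /=; case: eqP => [emo|_]; last by rewrite !subr0 mulr0 subr0.
      rewrite /cut; case: pselect => // ?; case: pselect => /= [[]|?]; first by rewrite ltxx.
      by rewrite subr0 mulr1 subrr.
    have -> : (e == mo a) = false.
      by apply/eqP => emo; move: ea; rewrite emo moa ltxx.
    rewrite mulr0 subr0; case: ifP => _; last by rewrite subr0.
    rewrite /cut; case: pselect => /= [?|[]]; last exact: Blt.
    by case: pselect => /= [?|[]]; rewrite ?subrr.
  have := idealB (rgt_ideal domR a) gda (evals_weight_gt rest).
  rewrite !rmorphB /= evals_scale evals_smon /good -/f; congr rgt; ring.
have below a y f : a <= a0 -> weight_gt gamma a0 f -> y = x - evals f -> rgt nu a y.
  move=> aa0 /evals_weight_gt fa0 ->; apply: rgt_le aa0 _.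
  exact: idealB (rgt_ideal domR a0) _ _.
(* A residue [y] of value below [b] would, by [step] at [rval y] (or [below] if that is at most
   [a0]), have value above its own. Successor and limit stages are treated alike. *)
have approx a : rge nu a (x - evals (ser (cut (fun b => value_lt nu b a)))).
  elim/(well_founded_ind (value_lt_wf noeR domR)): a => b IH.
  set y := x - _; apply: contrapT => nby; have y0 := rgeN_neq0 nby.
  have yb : rval nu y < b by apply: og_leNlt => /(rge_neq0 _ _ y0).
  have vy : value_lt nu (rval nu y) b by split=> //; exists y.
  apply: (rval_rgtN (nu := nu) y0).
  have [ya0|a0y] := pselect (rval nu y <= a0); first by apply: below ya0 _ _; last by [].
  apply: step => //; [exact: og_leNlt|exact: mon_attained y0| |exact: IH].
  by move=> e ey; split; [exact: lt_trans yb|exact: attained].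
exists (ser (cut setT)); first exact: ser_gt.
apply/eqP; rewrite eq_sym -subr_eq0; apply/negP => /negP y0.
apply: (rval_rgtN (nu := nu) y0); set y := x - _.
have [ya0|a0y] := pselect (rval nu y <= a0); first by apply: below ya0 _ _; last by [].
by apply: step => //; [exact: og_leNlt|exact: mon_attained y0].
Qed.

Lemma evals_surj x : exists f, evals f = x.
Proof.
have [c /(mrgt domR) /evals_surj_gt[f _ fx]] := iota_mod_m kR x.
exists (c *: 1 + f); rewrite rmorphD /= evals_scale rmorph1 mulr1 fx.
by rewrite addrC subrK.
Qed.

(** * The kernel and its binomials *)

Local Notation F := (val_filtration nu).
Local Notation Sw := (weight_filtration k gamma).
Local Notation gr_eval :=
  (poly_eval (gr_scalar F iota) (fun i => gr_class F (gamma i) (xi i))).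

Lemma xi_fge i : fge F (gamma i) (xi i).
Proof. exact: xi_ge. Qed.

Lemma gr_eval_rmorphism :
  exists g : {rmorphism {malg k[{cmonom I}]} -> gr F}, gr_eval = g.
Proof. exact (gr_poly_eval_rmorphism (iota_fge iota domR) _). Qed.

Lemma gr_eval_eq0 p : gr_eval p = 0 <->
  forall a : nneg Phi,
    rgt nu a (\sum_(e <- msupp p | nnweight gamma e == a) iota p@_e * mon e).
Proof. exact: (gr_poly_eval_eq0 (iota_fge iota domR) xi_fge). Qed.

Lemma gr_eval_ideal : ideal [set p | gr_eval p = 0].
Proof. by have [g ->] := gr_eval_rmorphism; exact: ideal_kernel. Qed.

Definition binomial_rel e d (lam : k) : Prop :=
  [/\ e <> d, lam <> 0, weight e = weight d
    & rgt nu (weight e) (mon e - iota lam * mon d)].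

Lemma mbinomial_ker e d lam : binomial_rel e d lam -> gr_eval (mbinomial e d lam) = 0.
Proof.
by move=> [_ _ wed ed]; exact: (gr_poly_eval_mbinomial_eq0 (iota_fge iota domR) xi_fge wed ed).
Qed.

(** A monomial alone in its weight within [p] could not cancel, as its value equals its weight; any
    other monomial of that weight is proportional to it modulo higher value. *)
Lemma binomial_partner e p : gr_eval p = 0 -> e \in msupp p ->
  exists d lam, d \in msupp p /\ binomial_rel e d lam.
Proof.
move=> /gr_eval_eq0 /(_ (nnweight gamma e)) p0 ep.
have [d [de dp wd]] : exists d, [/\ d != e, d \in msupp p & weight d = weight e].
  apply: contrapT => nd; apply: (@mon_rgtN e).
  have pe : p@_e != 0 by rewrite mcoeff_neq0.
  apply: (rgt_iotaM (iota := iota) domR pe); move: p0.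
  rewrite big_mkcond (big_fsetD1 e) //= eqxx big_seq big1 ?addr0 // => d dpe.
  have : d \in (msupp p `\ e)%fset by exact: dpe.
  rewrite in_fsetD1 => /andP[de dp]; case: eqP => // /(congr1 val) /= wd.
  by case: nd; exists d.
have [||||lam lam0 ed] := @rgt_span1_neq0 _ _ _ _ domR _ _ kR ratR (weight e) (mon d) (mon e).
- by rewrite -wd; exact: mon_rge.
- by rewrite -wd; exact: mon_rgtN.
- exact: mon_rge.
- exact: mon_rgtN.
exists d, lam; split=> //; split=> //; [|exact/eqP].
by move=> ed'; rewrite ed' eqxx in de.
Qed.

(** Cancelling a monomial against a partner taken from the support of [p] shrinks that support,
    hence also keeps the weights in [W]. *)
Lemma gr_eval_ker_ind (W : set Phi) (Q : {malg k[{cmonom I}]} -> Prop) :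
  Q 0 ->
  (forall p c e d lam, Q p -> W (weight e) -> binomial_rel e d lam ->
    Q (p + c *: mbinomial e d lam)) ->
  forall p, gr_eval p = 0 -> (forall e, e \in msupp p -> W (weight e)) -> Q p.
Proof.
move=> Q0 QD p; have [n] := ubnP #|` msupp p|; elim: n p => // n IH p pn p0 pW.
have [->//|] := eqVneq p 0; rewrite -msupp_eq0 => /fset0Pn[e ep].
have [d [lam [dp edl]]] := binomial_partner p0 ep.
pose q := p - p@_e *: mbinomial e d lam.
have qE c : q@_c = p@_c - p@_e * ((e == c)%:R - lam *+ (d == c)).
  by rewrite /q mcoeffB mcoeffZ mcoeff_mbinomial.
have qe : q@_e = 0.
  rewrite qE eqxx; have [de|_] := eqVneq d e; first by case: edl => /(_ (esym de)).
  by rewrite mulr0n subr0 mulr1 subrr.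
have qp c : c \in msupp q -> c \in msupp p.
  apply: contraLR => cp; rewrite -mcoeff_eq0 qE (mcoeff_outdom cp).
  have [ec|_] := eqVneq e c; first by rewrite ec (negbTE cp) in ep.
  have [dc|_] := eqVneq d c; first by rewrite dc (negbTE cp) in dp.
  by rewrite !mulr0n !subr0 mulr0 ?subr0.
rewrite -(subrK (p@_e *: mbinomial e d lam) p); apply: QD => //; last exact: pW.
apply: IH => [||c /qp/pW//].
  rewrite -ltnS; apply: leq_trans pn; rewrite ltnS; apply: fproper_ltn_card.
  rewrite fproperE; apply/andP; split; first exact/fsubsetP/qp.
  by apply/fsubsetPn; exists e; rewrite // -mcoeff_eq0 qe.
apply: (idealB gr_eval_ideal) p0 _; rewrite -mul_malgC.
exact: ideal_mull gr_eval_ideal (mbinomial_ker edl).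
Qed.

(** The homogeneous component of weight [a]; [finite_weight] ensures that [fset_set] loses
    nothing. *)
Definition hpart a f : {malg k[{cmonom I}]} :=
  [malg e in fset_set [set e | weight e = a] => f e].

Lemma hpartE a f e : (hpart a f)@_e = if weight e == a then f e else 0.
Proof.
rewrite mcoeffE in_fset_set; last exact: finite_weight.
by congr (if _ then _ else _); apply/idP/eqP => [/set_mem|/mem_set].
Qed.

Lemma msupp_hpart a f e : e \in msupp (hpart a f) -> weight e = a.
Proof. by rewrite -mcoeff_neq0 hpartE; have [//|_] := eqVneq (weight e) a; rewrite eqxx. Qed.

Lemma hpart_gt a f : weight_ge gamma a f -> weight_gt gamma a (f - series_of (hpart a f)).
Proof.
move=> fa e; change (f e - (hpart a f)@_e != 0 -> a < weight e).
rewrite hpartE; have [_|ea] := eqVneq (weight e) a; first by rewrite subrr eqxx.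
by rewrite subr0 => /fa; rewrite le_eqVlt eq_sym (negbTE ea).
Qed.

(** The value of the component is minus that of the terms of weight above [a], hence lies in
    [rgt a]. *)
Lemma evals_ker_hpart a f : weight_ge gamma a f -> evals f = 0 -> gr_eval (hpart a f) = 0.
Proof.
move=> fa f0; apply/gr_eval_eq0 => b.
have [ab|ba] := eqVneq a (b : Phi); last first.
  rewrite big_seq_cond big1; first exact: ideal0 (rgt_ideal domR b).
  move=> e /andP[/msupp_hpart ea /eqP eb]; case/eqP: ba.
  by rewrite -ea -eb.
have -> : \sum_(e <- msupp (hpart a f) | nnweight gamma e == b)
    iota (hpart a f)@_e * mon e = poly_eval iota xi (hpart a f).
  rewrite /poly_eval mmapE [RHS]big_seq [LHS]big_seq_cond.
  apply: eq_bigl => e; have [/msupp_hpart ea|//] := boolP (e \in msupp _).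
  have -> : nnweight gamma e = b by apply: val_inj; rewrite /= ea.
  by rewrite eqxx.
have := evals_weight_gt (hpart_gt fa).
rewrite rmorphB /= f0 sub0r evals_series_of => /(idealN (rgt_ideal domR a)).
by rewrite opprK -ab.
Qed.

Lemma weight_gtB a f g : weight_gt gamma a f -> weight_gt gamma a g ->
  weight_gt gamma a (f - g).
Proof. by move=> fa ga e /series_sub_neq0[/fa|/ga]. Qed.

Lemma weight_gtN a f : weight_gt gamma a f -> weight_gt gamma a (- f).
Proof. by move=> fa; rewrite -sub0r; apply: weight_gtB fa => e; rewrite eqxx. Qed.

Lemma weight_gtD a f g : weight_gt gamma a f -> weight_gt gamma a g ->
  weight_gt gamma a (f + g).
Proof. by move=> fa /weight_gtN ga; rewrite -[g]opprK; exact: weight_gtB. Qed.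

Lemma weight_gt_ge a f : weight_gt gamma a f -> weight_ge gamma a f.
Proof. by move=> fa e /fa/ltW. Qed.

Lemma weight_gtZ a c f : weight_gt gamma a f -> weight_gt gamma a (c *: f).
Proof.
move=> fa e ce; apply: fa; apply: contra_neq ce => fe.
by change (c * f e = 0); rewrite fe mulr0.
Qed.

Record deformation := Deformation {
  def_lead : {cmonom I};
  def_tail : {cmonom I};
  def_coef : k;
  def_series : formal_series k I;
  def_rel : binomial_rel def_lead def_tail def_coef;
  def_gt : weight_gt gamma (weight def_lead)
    (def_series - (smon k def_lead - def_coef *: smon k def_tail));
  def_ker : evals def_series = 0
}.

Lemma deformation_exists e d lam : binomial_rel e d lam ->
  exists l, [/\ def_lead l = e, def_tail l = d & def_coef l = lam].
Proof.
move=> edl; have [_ _ _ ed] := edl.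
have [h hgt hE] := evals_surj_gt ed.
pose b : formal_series k I := smon k e - lam *: smon k d.
have bh : weight_gt gamma (weight e) ((b - h) - b).
  by rewrite addrAC subrr add0r; exact: weight_gtN.
have ker : evals (b - h) = 0.
  by rewrite !rmorphB /= evals_scale !evals_smon hE subrr.
by exists (Deformation edl bh ker).
Qed.

Lemma evals_ker_ideal : ideal [set f | evals f = 0].
Proof. exact: ideal_kernel. Qed.

(** Weights of monomials are values of elements of [R], so [min_rval] applies. *)
Lemma min_weight f : f != 0 -> exists2 e, f e != 0 & weight_ge gamma (weight e) f.
Proof.
move=> f0; have [e0 fe0] : exists e, f e != 0.
  apply: contrapT => nf; case/eqP: f0; apply/funext => e.
  by apply: contrapT => /eqP fe; apply: nf; exists e.
have [|x [e fe <-] [_ emin]] := @min_rval _ _ _ _ noeR domR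
    [set x | exists2 e, f e != 0 & mon e = x] (mon e0) _ (mon_neq0 e0).
  by exists e0.
exists e => // d fd; have := emin (mon d); have [_ ->] := rval_mon e.
by have [d0 ->] := rval_mon d; apply=> //; exists d.
Qed.

Local Notation J := (ideal_gen (range def_series)).

(* An element of higher weight of the kernel can be added to a deformation of a
   binomial without changing the binomial, hence it is a difference of two
   deformations of the same binomial. *)
Lemma ideal_gen_deformations : J = [set f | evals f = 0].
Proof.
apply/seteqP; split=> [|f f0].
  by apply: ideal_gen_sub evals_ker_ideal _ => _ [l _ <-]; exact: def_ker.
have iJ := ideal_gen_ideal (range def_series).
have JF l : J (def_series l) by apply: sub_ideal_gen; exists l.
have [->|fn0] := eqVneq f 0; first exact: ideal0.
have [e fe fa] := min_weight fn0; set a := weight e in fa.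
(* [Q] supplies an element [g] of [J] agreeing with [p] up to weights above [a] and, unless [p = 0],
   some deformation of weight [a], which will absorb the remainder [f - g]. *)
pose Q p := (exists2 g, J g & weight_gt gamma a (g - series_of p)) /\
  (p = 0 \/ exists l, weight (def_lead l) = a).
have [||||[g Jg gp] [p0|[l la]]] := @gr_eval_ker_ind [set a] Q _ _ (hpart a f).
- split; last by left.
  exists 0; first exact: ideal0.
  by rewrite sub0r => d; change (- (0 : {malg k[{cmonom I}]})@_d != 0 -> a < weight d);
    rewrite mcoeff0 oppr0 eqxx.
- move=> p c e' d lam [[g Jg gp] _] /= wa edl.
  have [l [le ld ll]] := deformation_exists edl.
  split; last by right; exists l; rewrite le.
  exists (g + c *: def_series l).
    by apply: (idealD iJ Jg); rewrite -mulr_algl; exact: (ideal_mull _ iJ (JF l)).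
  have -> : g + c *: def_series l - series_of (p + c *: mbinomial e' d lam) =
      (g - series_of p) +
      c *: (def_series l - (smon k (def_lead l) - def_coef l *: smon k (def_tail l))).
    apply/funext => e1; rewrite le ld ll.
    change (g e1 + c * def_series l e1 - (p + c *: mbinomial e' d lam)@_e1 =
      (g e1 - p@_e1) + c * (def_series l e1 - ((e1 == e')%:R - lam * (e1 == d)%:R))).
    rewrite mcoeffD mcoeffZ mcoeff_mbinomial !(eq_sym e1) -mulr_natr; ring.
  by apply: weight_gtD => //; apply: weight_gtZ; rewrite -wa -le; exact: def_gt.
- exact: evals_ker_hpart.
- by move=> d /msupp_hpart.
- by have /eqP := hpartE a f e; rewrite p0 mcoeff0 eqxx eq_sym (negbTE fe).
have rest_gt : weight_gt gamma (weight (def_lead l)) (f - g).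
  rewrite la; have -> : f - g = (f - series_of (hpart a f)) - (g - series_of (hpart a f)).
    by rewrite opprB addrA subrK.
  by apply: weight_gtB => //; exact: hpart_gt.
have g0 : evals g = 0 by apply: (ideal_gen_sub evals_ker_ideal) Jg => _ [l' _ <-]; exact: def_ker.
have [l2 l2E] : exists l2, def_series l2 = def_series l + (f - g).
  have gt : weight_gt gamma (weight (def_lead l)) (def_series l + (f - g) -
      (smon k (def_lead l) - def_coef l *: smon k (def_tail l))).
    by rewrite addrAC; apply: weight_gtD => //; exact: def_gt.
  have ker : evals (def_series l + (f - g)) = 0.
    by rewrite rmorphD rmorphB /= def_ker f0 g0 subrr addr0.
  by exists (Deformation (def_rel l) gt ker).
have -> : f = def_series l2 - def_series l + g.
  by rewrite l2E [def_series l + _]addrC addrK subrK.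
by apply: (idealD iJ _ Jg); exact: (idealB iJ (JF l2) (JF l)).
Qed.

(** * Comparison of the graded rings, and closedness of the kernel *)

Local Notation S0 := (GRing.in_alg (formal_series k I)).

Lemma scalar_fge c : fge Sw mone (S0 c).
Proof.
move=> e; change (c * (e == mone)%:R != 0 -> 0 <= weight e).
by have [->|_] := eqVneq e mone; rewrite ?weight1 ?lexx // mulr0 eqxx.
Qed.

Lemma svar_fge i : fge Sw (gamma i) (svar k i).
Proof.
move=> e; change ((e == ucm i)%:R != 0 :> k -> (gamma i : Phi) <= weight e).
have [->|_] := eqVneq e (ucm i); last by rewrite eqxx.
by rewrite /Defs.weight mdomU big_seq_fset1 cmUU mulr1n.
Qed.

Lemma gr_poly_rmorphism :
  exists g : {rmorphism {malg k[{cmonom I}]} -> gr Sw}, gr_poly gamma = g.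
Proof. exact (gr_poly_eval_rmorphism scalar_fge _). Qed.

Lemma gr_poly_hpart (a : nneg Phi) f : weight_ge gamma a f ->
  gr_poly gamma (hpart a f) = gr_class Sw a f.
Proof.
move=> fa; have [pa pE] := gr_poly_eval_homogeneous scalar_fge svar_fge (@msupp_hpart a f).
rewrite poly_eval_svar in pa pE.
apply: etrans pE _; apply/(gr_classP pa (fa : fge Sw a f)).
rewrite -opprB; apply: weight_gtN; exact: hpart_gt.
Qed.

Lemma evals_filtered : filtered_map Sw F evals.
Proof. by split=> a f; [exact: evals_weight_ge|exact: evals_weight_gt]. Qed.

Lemma evals_continuous : continuous (evals : filtered Sw -> filtered F).
Proof.
move=> f V [a aV]; exists a => g fg; apply: aV.
by have := evals_weight_gt fg; rewrite rmorphB.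
Qed.

Lemma gr_map_evals p : gr_map Sw F evals (gr_poly gamma p) = gr_eval p.
Proof.
have sc c : evals (S0 c) = iota c.
  by rewrite evals_scale rmorph1 mulr1.
have -> : (fun i => gr_class F (gamma i) (xi i)) =
    (fun i => gr_class F (gamma i) (evals (svar k i))).
  by apply/funext => i; rewrite evals_smon mon_evalU.
exact: (gr_map_poly_eval evals_filtered scalar_fge svar_fge sc).
Qed.

Lemma ideal_gen_mbinomial :
  ideal_gen (range (fun l => mbinomial (def_lead l) (def_tail l) (def_coef l))) =
  [set p | gr_eval p = 0].
Proof.
set K := ideal_gen _; have iK : ideal K by exact: ideal_gen_ideal.
apply/seteqP; split.
  by apply: (ideal_gen_sub gr_eval_ideal) => _ [l _ <-]; exact: mbinomial_ker (def_rel l).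
move=> p p0; apply: (@gr_eval_ker_ind setT K) p0 _ => //; first exact: ideal0.
move=> q c e d lam Kq _ /deformation_exists[l [<- <- <-]].
apply: (idealD iK Kq); rewrite -mul_malgC; apply: (ideal_mull _ iK).
by apply: sub_ideal_gen; exists l.
Qed.

Lemma weight_ge_scale_smon c e : weight_ge gamma (weight e) (c *: smon k e).
Proof.
move=> d; change (c * (d == e)%:R != 0 -> weight e <= weight d).
by have [->//|_] := eqVneq d e; rewrite mulr0 eqxx.
Qed.

Lemma def_weight_ge l : weight_ge gamma (weight (def_lead l)) (def_series l).
Proof.
have [_ _ wE _] := def_rel l.
rewrite -(subrK (smon k (def_lead l) - def_coef l *: smon k (def_tail l)) (def_series l)).
apply: (@fgeD _ _ Sw (nnweight gamma (def_lead l))).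
  exact/weight_gt_ge/def_gt.
apply: (@fgeB _ _ Sw (nnweight gamma (def_lead l))).
  by rewrite -[smon k _]scale1r; exact: weight_ge_scale_smon.
by rewrite /= wE; exact: weight_ge_scale_smon.
Qed.

Lemma hpart_def l : hpart (weight (def_lead l)) (def_series l) =
  mbinomial (def_lead l) (def_tail l) (def_coef l).
Proof.
have [_ _ wE _] := def_rel l.
apply/malgP => e; rewrite hpartE mcoeff_mbinomial.
have [we|we] := eqVneq (weight e) (weight (def_lead l)); last first.
  have [le|_] := eqVneq (def_lead l) e; first by rewrite le eqxx in we.
  have [te|_] := eqVneq (def_tail l) e; first by rewrite wE te eqxx in we.
  by rewrite !mulr0n subrr.
have := @def_gt l e; rewrite we ltxx.
set b := _ - def_coef l *: _ => nlt.
have -> : def_series l e = b e.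
  apply/eqP; rewrite -subr_eq0; apply/negP => /negP.
  by move=> /nlt.
rewrite /b; change ((e == def_lead l)%:R - def_coef l * (e == def_tail l)%:R =
  (def_lead l == e)%:R - def_coef l *+ (def_tail l == e)).
by rewrite !(eq_sym e) mulr_natr.
Qed.

(** An initial form of a kernel element is the class of its [hpart], which [gr_eval] kills;
    conversely each binomial is the initial form of a deformation. *)
Lemma initial_ideal_ker :
  initial_ideal Sw [set f | evals f = 0] = gr_poly gamma @` [set p | gr_eval p = 0].
Proof.
have [g gE] := gr_poly_rmorphism.
(* Surjectivity is what makes the image of the binomial ideal an ideal. *)
have gsurj y : exists p, g p = y.
  have [l [lF ->]] := gr_sum_classes y; rewrite big_seq.
  elim/big_rec: _ => [|t z /lF tF [q <-]]; first by exists 0; rewrite rmorph0.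
  by exists (hpart t.1 t.2 + q); rewrite rmorphD -gE gr_poly_hpart.
rewrite gE; apply/seteqP; split.
  apply: ideal_gen_sub.
    exact: ideal_image gsurj gr_eval_ideal.
  move=> y [f f0 [a [fa _ ->]]]; exists (hpart a f); first exact: evals_ker_hpart.
  by rewrite -gE gr_poly_hpart.
set K := initial_ideal _ _; have iK : ideal K by exact: ideal_gen_ideal.
move=> _ [p p0 <-]; move: p p0; rewrite -ideal_gen_mbinomial.
suff : ideal_gen (range (fun l => mbinomial (def_lead l) (def_tail l) (def_coef l)))
    `<=` [set p | K (g p)] by move=> h p /h.
apply: ideal_gen_sub; first exact: ideal_preimage.
move=> _ [l _ <-] /=; rewrite -hpart_def -gE.
have wF : fge Sw (nnweight gamma (def_lead l)) (def_series l) by exact: def_weight_ge.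
rewrite (@gr_poly_hpart (nnweight gamma (def_lead l))) //.
apply: sub_ideal_gen; exists (def_series l); first exact: def_ker.
exists (nnweight gamma (def_lead l)); split=> // lgt.
have := @hpartE (weight (def_lead l)) (def_series l) (def_lead l).
rewrite hpart_def mcoeff_mbinomial !eqxx; have [ne _ _ _] := def_rel l.
have [tl|_] := eqVneq (def_tail l) (def_lead l); first by case: ne.
rewrite subr0 => l1.
have : def_series l (def_lead l) != 0 by rewrite -l1 oner_neq0.
by move=> /lgt; rewrite ltxx.
Qed.

Lemma overweight_deformations :
  overweight_deformation gamma def_lead def_tail def_coef def_series.
Proof.
split=> [l|]; last first.
  by rewrite ideal_gen_deformations ideal_gen_mbinomial; exact: initial_ideal_ker.
have [_ _ wE _] := def_rel l; split=> //.
exists (def_series l - (smon k (def_lead l) - def_coef l *: smon k (def_tail l))).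
  exact: def_gt.
by rewrite addrC subrK.
Qed.

Lemma evals_ker_closed :
  [set f | evals f = 0] = closure ([set f | evals f = 0] : set (filtered Sw)).
Proof.
apply/seteqP; split; first by move=> f f0 B /nbhs_singleton Bf; exists f.
move=> f fcl; apply: contrapT => /eqP f0.
(* A kernel element this close to [f] would force [evals f] to have value above its own. *)
pose a : nneg Phi := NNeg (rval_ge0 domR f0).
have [|g [g0 fg]] := fcl [set g | fgt Sw a ((g : formal_series k I) - (f : formal_series k I))].
  by exists a.
apply: (rval_rgtN (nu := nu) f0); have := evals_weight_gt fg.
rewrite rmorphB /= g0 sub0r => /(idealN (rgt_ideal domR _)).
by rewrite opprK.
Qed.

Lemma evals_presentation :
  exists Pi : {rmorphism formal_series k I -> R},
    [/\ forall c : k, Pi (c%:A) = iota c,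
        forall i, Pi (svar k i) = xi i,
        continuous (Pi : filtered Sw -> filtered F),
        forall x : R, exists f, Pi f = x
      & filtered_map Sw F Pi /\
        forall p, gr_map Sw F Pi (gr_poly gamma p) = gr_eval p] /\
  exists (L : Type) (e d : L -> {cmonom I}) (lam : L -> k)
         (D : L -> formal_series k I),
    [/\ forall l, e l <> d l /\ lam l <> 0,
        ideal_gen (range (fun l => mbinomial (e l) (d l) (lam l))) =
          [set p | gr_eval p = 0],
        overweight_deformation gamma e d lam D
      & [set f | Pi f = 0] = closure (ideal_gen (range D) : set (filtered Sw))].
Proof.
exists (evals : {rmorphism _ -> _}); split.
  split; first by move=> c; rewrite /= evals_scale rmorph1 mulr1.
  - by move=> i; rewrite /= evals_smon mon_evalU.
  - exact: evals_continuous.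
  - exact: evals_surj.
  - by split; [exact: evals_filtered|exact: gr_map_evals].
exists deformation, def_lead, def_tail, def_coef, def_series; split.
- by move=> l; have [] := def_rel l.
- exact: ideal_gen_mbinomial.
- exact: overweight_deformations.
- by rewrite ideal_gen_deformations; exact: evals_ker_closed.
Qed.

End Evaluation.

Theorem theorem4p12
    (R : idomainType) (m : set R)
    (Rlocal : local_ring m) (Rnoetherian : noetherian R)
    (Rcomplete : adic_complete m) (Requi : equicharacteristic m)
    (k : fieldType) (iota : {rmorphism k -> R})
    (kR : field_of_representatives m iota)
    (Phi : orderedGroupType) (nu : valuation {fraction R} Phi)
    (nu_dominates : dominates nu m) (nu_rational : rational nu)
    (I : choiceType) (gamma : I -> nneg Phi)
    (xibar : I -> gr (val_filtration nu))
    (xibar_homogeneous : forall i, homogeneous (val_filtration nu) (gamma i) (xibar i))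
    (xibar_minimal :
       minimal_generators (gr_scalar (val_filtration nu) iota) xibar) :
  let Rnu := val_filtration nu in
  let Sw := weight_filtration k gamma in
  let gr_eval := poly_eval (gr_scalar Rnu iota) xibar in
  exists xi : I -> R, (forall i, initial_form Rnu (xi i) (xibar i)) /\
  exists Pi : {rmorphism formal_series k I -> R},
    [/\ forall c : k, Pi (c%:A) = iota c,
        forall i, Pi (svar k i) = xi i,
        continuous (Pi : filtered Sw -> filtered Rnu),
        forall x : R, exists f, Pi f = x
      & filtered_map Sw Rnu Pi /\
        forall p, gr_map Sw Rnu Pi (gr_poly gamma p) = gr_eval p] /\
  exists (L : Type) (e d : L -> {cmonom I}) (lam : L -> k)
         (F : L -> formal_series k I),
    [/\ forall l, e l <> d l /\ lam l <> 0,
        ideal_gen (range (fun l => mbinomial (e l) (d l) (lam l))) =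
          [set p | gr_eval p = 0],
        overweight_deformation gamma e d lam F
      & [set f | Pi f = 0] = closure (ideal_gen (range F) : set (filtered Sw))].

Proof.
move=> Rnu Sw gr_eval; rewrite {}/gr_eval {}/Sw {}/Rnu.
have [x0 /all_and2[x0_ge x0_class]] : exists x0 : I -> R, forall i,
    fge (val_filtration nu) (gamma i) (x0 i) /\
    xibar i = gr_class (val_filtration nu) (gamma i) (x0 i).
  have /choice[x0 x0P] i : exists x, fge (val_filtration nu) (gamma i) x /\
      xibar i = gr_class (val_filtration nu) (gamma i) x.
    by have [x xF xE] := xibar_homogeneous i; exists x.
  by exists x0.
(* The arbitrary representatives [x0] are exchanged for deepest ones with the same initial forms;
   convergence of formal sums depends on [xi_deep]. *)
have /choice[xi /all_and3[xi_ge xi_class xi_deep]] :=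
  deep_representative Rnoetherian kR nu_dominates nu_rational xibar_minimal x0_ge x0_class.
have xibarE : xibar = (fun i => gr_class (val_filtration nu) (gamma i) (xi i)).
  by apply/funext => i; rewrite xi_class.
have xi_gtN := representative_rgtN nu_dominates xibar_minimal xi_ge
  (fun i => esym (xi_class i)).
exists xi; split.
  by move=> i; exists (gamma i); split; [exact: xi_ge|exact: xi_gtN|rewrite xi_class].
have gammaI := gamma_inj kR nu_dominates nu_rational xibar_minimal x0_ge x0_class.
have gamma_pos := gamma_gt0 kR nu_dominates xibar_minimal x0_ge x0_class.
have xi_generates := xibar_minimal.1; rewrite xibarE in xi_generates *.
exact: (evals_presentation Rnoetherian Rcomplete kR nu_dominates nu_rational
  gammaI gamma_pos xi_ge xi_gtN xi_deep xi_generates).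
Qed.
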